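(* Let $\Omega$ be a bounded open subset of $\mathbb{R}^n$ with $C^2$ boundary. Suppose that $f$ and $g$ satisfy (f0), (f1), (f2) and (g1) as listed in the context. Then the value function $$u(t,x)=\inf_{\gamma\in\Gamma,\ \gamma(t)=x}\left\{\int_t^T f(s,\gamma(s),\dot\gamma(s))\,ds+g(\gamma(T))\right\},\qquad (t,x)\in[0,T]\times\overline\Omega,$$ is Lipschitz continuous in $(0,T)\times\overline\Omega$.
   Context: $T>0$; $U\subset\mathbb{R}^n$ is open with $\overline\Omega\subset U$. $AC(0,T;\mathbb{R}^n)$ is the set of absolutely continuous functions $[0,T]\to\mathbb{R}^n$ and $\Gamma=\{\gamma\in AC(0,T;\mathbb{R}^n):\gamma(t)\in\overline\Omega\ \forall t\in[0,T]\}$. Assumptions on $f:[0,T]\times U\times\mathbb{R}^n\to\mathbb{R}$ and $g:U\to\mathbb{R}$: (g1) $g\in C^1_b(U)$ ($C^1$, bounded with bounded first derivatives). (f0) $f$ is continuous on $[0,T]\times U\times\mathbb{R}^n$; for all $t$, $(x,v)\mapsto f(t,x,v)$ is differentiable; $D_xf,D_vf$ are continuous on $[0,T]\times U\times\mathbb{R}^n$; and there is $M\ge0$ with $|f(t,x,0)|+|D_xf(t,x,0)|+|D_vf(t,x,0)|\le M$ for all $(t,x)\in[0,T]\times U$. (f1) For all $t$ the map $(x,v)\mapsto D_vf(t,x,v)$ is continuously differentiable and there is $\mu\ge1$ with $\frac{I}{\mu}\le D^2_{vv}f(t,x,v)\le I\mu$ and $\|D^2_{vx}f(t,x,v)\|\le\mu(1+|v|)$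 for all $(t,x,v)\in[0,T]\times U\times\mathbb{R}^n$. (f2) For all $(x,v)\in U\times\mathbb{R}^n$, $t\mapsto f(t,x,v)$ and $t\mapsto D_vf(t,x,v)$ are Lipschitz continuous, and there is $\kappa\ge0$ with $|f(t,x,v)-f(s,x,v)|\le\kappa(1+|v|^2)|t-s|$ and $|D_vf(t,x,v)-D_vf(s,x,v)|\le\kappa(1+|v|)|t-s|$ for all $t,s\in[0,T]$, $x\in U$, $v\in\mathbb{R}^n$. *)

(* Defs.v *)
From HB Require Import structures.
From mathcomp Require Import all_boot all_order all_algebra.
From mathcomp Require Import all_classical all_reals all_analysis.

Set Implicit Arguments.
Unset Strict Implicit.
Unset Printing Implicit Defensive.

Import Order.TTheory GRing.Theory Num.Theory.
Import numFieldNormedType.Exports.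

Local Open Scope classical_set_scope.
Local Open Scope ring_scope.

(* The norm that the library puts on 'rV[R]_n is the maximum norm, and it has
   no real inner product: [enorm] and [opnorm] are the Euclidean norm and the
   operator norm that it induces (for matrices acting on row vectors). *)
Definition dotr (R : realType) (n : nat) (x y : 'rV[R]_n) : R :=
  \sum_(i < n) x 0 i * y 0 i.

Definition enorm (R : realType) (n : nat) (x : 'rV[R]_n) : R :=
  Num.sqrt (dotr x x).

Definition opnorm (R : realType) (n : nat) (A : 'M[R]_n) : R :=
  sup [set enorm (h *m A) | h in [set h : 'rV[R]_n | enorm h <= 1]].

Definition gradient (R : realType) (n : nat) (F : 'rV[R]_n -> R)
    (x : 'rV[R]_n) : 'rV[R]_n :=
  \row_(i < n) 'D_(delta_mx 0 i) F x.

(* These are used on finite-dimensional spaces and on open sets A only, where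
   continuity of all directional derivatives is continuity of the
   differential. *)
Definition C1_on (R : realType) (V W : normedModType R) (A : set V)
    (F : V -> W) : Prop :=
  (forall x, A x -> differentiable F x) /\
  (forall h : V, {within A, continuous (fun x => 'D_h F x)}).

Definition C2_on (R : realType) (V W : normedModType R) (A : set V)
    (F : V -> W) : Prop :=
  C1_on A F /\ (forall h : V, C1_on A (fun x => 'D_h F x)).

(* Near each boundary point, in suitable orthonormal coordinates y *m Q,
   Omega is the strict epigraph of a C^2 function of the n - 1 coordinates
   other than the i-th one. *)
Definition C2_boundary (R : realType) (n : nat) (Omega : set 'rV[R]_n) : Prop :=
  forall x0 : 'rV[R]_n, (closure Omega `\` interior Omega) x0 ->
  exists (r : R) (Q : 'M[R]_n) (i : 'I_n) (phi : 'rV[R]_n.-1 -> R),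
    [/\ 0 < r, Q *m Q^T = 1%:M, C2_on setT phi &
        forall y : 'rV[R]_n, enorm (y - x0) < r ->
          (Omega y <-> phi (col' i (y *m Q)) < (y *m Q) 0 i)].

Definition absolutely_continuous (R : realType) (n : nat) (a b : R)
    (gamma : R -> 'rV[R]_n) : Prop :=
  forall eps : R, 0 < eps -> exists2 delta : R, 0 < delta &
    forall (N : nat) (l r : 'I_N -> R),
      (forall k, [&& a <= l k, l k <= r k & r k <= b]) ->
      trivIset setT (fun k => `](l k), (r k)[%classic) ->
      \sum_(k < N) (r k - l k) < delta ->
      \sum_(k < N) enorm (gamma (r k) - gamma (l k)) < eps.

(* Curves, f and g are total functions; only their values on [0, T],
   [0, T] x U x R^n and U matter. *)
Definition admissible (R : realType) (n : nat) (T : R)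
    (Omega : set 'rV[R]_n) (gamma : R -> 'rV[R]_n) : Prop :=
  absolutely_continuous 0 T gamma /\
  (forall t, t \in `[0, T] -> closure Omega (gamma t)).

Definition Dx (R : realType) (n : nat)
    (f : R -> 'rV[R]_n -> 'rV[R]_n -> R) (t : R) (x v : 'rV[R]_n) : 'rV[R]_n :=
  gradient (fun y => f t y v) x.

Definition Dv (R : realType) (n : nat)
    (f : R -> 'rV[R]_n -> 'rV[R]_n -> R) (t : R) (x v : 'rV[R]_n) : 'rV[R]_n :=
  gradient (fun w => f t x w) v.

Definition D2vv (R : realType) (n : nat)
    (f : R -> 'rV[R]_n -> 'rV[R]_n -> R) (t : R) (x v : 'rV[R]_n) : 'M[R]_n :=
  jacobian (fun w => Dv f t x w) v.

Definition D2vx (R : realType) (n : nat)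
    (f : R -> 'rV[R]_n -> 'rV[R]_n -> R) (t : R) (x v : 'rV[R]_n) : 'M[R]_n :=
  jacobian (fun y => Dv f t y v) x.

Definition hyp_g1 (R : realType) (n : nat) (U : set 'rV[R]_n)
    (g : 'rV[R]_n -> R) : Prop :=
  C1_on U g /\
  (exists K : R, forall x, U x -> `|g x| <= K /\ enorm (gradient g x) <= K).

Definition hyp_f0 (R : realType) (n : nat) (T : R) (U : set 'rV[R]_n)
    (f : R -> 'rV[R]_n -> 'rV[R]_n -> R) : Prop :=
  let dom : set (R * 'rV[R]_n * 'rV[R]_n) :=
    `[0, T]%classic `*` U `*` setT in
  [/\ {within dom, continuous (fun p => f p.1.1 p.1.2 p.2)},
      forall t x v, t \in `[0, T] -> U x ->
        differentiable (fun p : 'rV[R]_n * 'rV[R]_n => f t p.1 p.2) (x, v),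
      {within dom, continuous (fun p => Dx f p.1.1 p.1.2 p.2)},
      {within dom, continuous (fun p => Dv f p.1.1 p.1.2 p.2)} &
      exists2 M : R, 0 <= M & forall t x, t \in `[0, T] -> U x ->
        `|f t x 0| + enorm (Dx f t x 0) + enorm (Dv f t x 0) <= M].

Definition hyp_f1 (R : realType) (n : nat) (T : R) (U : set 'rV[R]_n)
    (f : R -> 'rV[R]_n -> 'rV[R]_n -> R) : Prop :=
  (forall t, t \in `[0, T] ->
    C1_on (U `*` setT) (fun p : 'rV[R]_n * 'rV[R]_n => Dv f t p.1 p.2)) /\
  (exists2 mu : R, 1 <= mu & forall t x v, t \in `[0, T] -> U x ->
    (forall h : 'rV[R]_n,
      dotr h h / mu <= dotr (h *m D2vv f t x v) h <= dotr h h * mu) /\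
    opnorm (D2vx f t x v) <= mu * (1 + enorm v)).

Definition hyp_f2 (R : realType) (n : nat) (T : R) (U : set 'rV[R]_n)
    (f : R -> 'rV[R]_n -> 'rV[R]_n -> R) : Prop :=
  (forall x v, U x ->
    [lipschitz f t x v | t in `[0, T]%classic] /\
    [lipschitz Dv f t x v | t in `[0, T]%classic]) /\
  (exists2 kappa : R, 0 <= kappa &
    forall t s x v, t \in `[0, T] -> s \in `[0, T] -> U x ->
      `|f t x v - f s x v| <= kappa * (1 + enorm v ^+ 2) * `|t - s| /\
      enorm (Dv f t x v - Dv f s x v) <= kappa * (1 + enorm v) * `|t - s|).

(* The integrand is bounded below under the hypotheses on f, so the integral
   is well defined in ]-oo, +oo]; +oo is not excluded for a given curve. *)
Definition cost (R : realType) (n : nat) (T : R)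
    (f : R -> 'rV[R]_n -> 'rV[R]_n -> R) (g : 'rV[R]_n -> R)
    (t : R) (gamma : R -> 'rV[R]_n) : \bar R :=
  (\int[lebesgue_measure]_(s in `[t, T]) (f s (gamma s) (derive1 gamma s))%:E
   + (g (gamma T))%:E)%E.

Definition value (R : realType) (n : nat) (T : R) (Omega : set 'rV[R]_n)
    (f : R -> 'rV[R]_n -> 'rV[R]_n -> R) (g : 'rV[R]_n -> R)
    (t : R) (x : 'rV[R]_n) : \bar R :=
  ereal_inf [set cost T f g t gamma |
             gamma in [set gamma | admissible T Omega gamma /\ gamma t = x]].

(* Main.v *)
Require Import Defs.
From HB Require Import structures.
From mathcomp Require Import all_boot all_order all_algebra.
From mathcomp Require Import all_classical all_reals all_analysis.
From mathcomp Require Import measurable_realfun ring lra.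

Set Implicit Arguments.
Unset Strict Implicit.
Unset Printing Implicit Defensive.

Import Order.TTheory GRing.Theory Num.Theory.
Import numFieldNormedType.Exports.

Local Open Scope classical_set_scope.
Local Open Scope ring_scope.

(** The value function is compared at two points [(t, x)] and [(t', y)] directly,
    by modifying almost optimal curves; neither the existence nor the regularity
    of minimizers is used.

    Let [d = `|t - t'| + `|x - y|]. Strong convexity in the velocity and
    the bounds on the derivatives at velocity 0 give quadratic growth of [f], and
    changing the time by [h] or multiplying the velocity by [1 + h] increases
    [f] by at most a multiple of [h] times 1 plus the squared speed
    ([lagrangian_bounds]). Since staying at [x] costs at most
    [g x + C * (T - t)], a curve from [(t, x)] whose cost exceeds the infimum by
    at most [T - t] has energy at most a constant times [T - t]
    ([curve_energy]). If [4 * d <= T - t] and [d] is small, the competitor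
    [detour] first joins [y] to [x] inside the closure of [Omega] during a time
    [d], with bounded speed, and then follows the given curve with an affine
    change of time of slope [k] between 1 and 2 with
    [k - 1 <= 4 * d / (T - t)]. The errors made on the second part are
    proportional to [d / (T - t)] times the sum of [T - t] and of the energy,
    hence to [d]; so are those made on the first part ([detour_cost]). If
    [4 * d > T - t], the value at both points is within a multiple of [d] of [g],
    which is Lipschitz continuous ([value_near_final_time]); if [d] is not small,
    the boundedness of the value suffices.

    Points that are close to each other can be joined because the boundary is
    locally the graph of a Lipschitz function: the segment between them is
    raised by a parabola of height proportional to their distance
    ([chart_joinable]), and compactness makes the constants uniform
    ([closure_joinable]).

    The analytic input is the fundamental theorem of calculus for absolutely
    continuous curves ([absolutely_continuous_derivative]). The variation of an
    absolutely continuous function is absolutely continuous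
    ([uniformly_ac_variation_from]), its Stieltjes measure is dominated by the
    Lebesgue measure ([uniformly_ac_dominates]), and the Radon-Nikodym theorem
    and Lebesgue differentiation conclude. It makes the cost of a curve an
    integral of measurable functions over the complement of a null set
    ([curve_data]), and it bounds displacements by energies. *)

(** * Total variation of absolutely continuous functions *)

(** A pair [p] stands for the interval [[p.1, p.2]]; two such intervals are
    disjoint up to their end points when one lies to the left of the other. *)
Definition disjoint_pair (R : realType) (p q : R * R) : bool :=
  (p.2 <= q.1) || (q.2 <= p.1).

(** A finite list of intervals, possibly reduced to points, that are pairwise
    disjoint up to their end points. *)
Definition disjoint_family (R : realType) (s : seq (R * R)) : bool :=
  all (fun p => p.1 <= p.2) s && pairwise (@disjoint_pair R) s.

(** The sum of the lengths of the intervals of a list. *)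
Definition total_length (R : realType) (s : seq (R * R)) : R :=
  \sum_(p <- s) (p.2 - p.1).

(** The sum of the absolute increments of [h] over the intervals of a list. *)
Definition total_increment (R : realType) (h : R -> R) (s : seq (R * R)) : R :=
  \sum_(p <- s) `|h p.2 - h p.1|.

(** Absolute continuity of a real function on the whole line. The total
    increment is bounded by [e] in the wide sense, so that the bound passes to
    suprema. *)
Definition uniformly_ac (R : realType) (h : R -> R) : Prop :=
  forall e : R, 0 < e -> exists2 d : R, 0 < d &
    forall s, disjoint_family s -> total_length s < d ->
      total_increment h s <= e.

(** The consecutive intervals cut out by the points of [l], from [a] on. *)
Fixpoint pieces (R : realType) (a : R) (l : seq R) : seq (R * R) :=
  if l is b :: l' then (a, b) :: pieces b l' else [::].

Section pieces_theory.
Context {R : realType}.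
Implicit Types (a b : R) (l : seq R) (p q : R * R) (s A B : seq (R * R)).

Lemma variation_pieces a b (h : R -> R) l : itv_partition a b l ->
  variation a b h l = total_increment h (pieces a l).
Proof.
move=> abl; rewrite variation_zip// /total_increment.
elim: l a {abl} => [|c l IHl] a /=; first by rewrite !big_nil.
by rewrite !big_cons -IHl.
Qed.

Lemma mem_pieces a b l p : itv_partition a b l -> p \in pieces a l ->
  [/\ a <= p.1, p.1 <= p.2 & p.2 <= b].
Proof.
elim: l a => [//|c l IHl] a abl; rewrite inE => /predU1P[->/=|pl].
  have cb := itv_partition_le (itv_partition_cons abl).
  by case: abl => /= /andP[/ltW ac _] _.
have [cp pp pb] := IHl _ (itv_partition_cons abl) pl; split => //.
by apply: le_trans cp; case: abl => /= /andP[/ltW].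
Qed.

Lemma total_length_pieces a b l : itv_partition a b l ->
  total_length (pieces a l) = b - a.
Proof.
rewrite /total_length.
elim: l a => [|c l IHl] a abl /=.
  by rewrite big_nil (itv_partition_nil abl) subrr.
rewrite big_cons (IHl _ (itv_partition_cons abl)) /=; lra.
Qed.

Lemma disjoint_family_pieces a b l : itv_partition a b l ->
  disjoint_family (pieces a l).
Proof.
elim: l a => [//|c l IHl] a abl.
have cbl := itv_partition_cons abl.
have /andP[ml pl] := IHl _ cbl.
apply/andP; split => /=; first by rewrite ml andbT; case: abl => /= /andP[/ltW].
rewrite pl andbT; apply/allP => p /(mem_pieces cbl)[cp _ _].
by rewrite /disjoint_pair /= cp.
Qed.

Lemma disjoint_family_refine a b l s : itv_partition a b l ->
  disjoint_family ((a, b) :: s) -> disjoint_family (pieces a l ++ s).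
Proof.
move=> abl /andP[/= /andP[_ ms] /andP[ds ps]].
have /andP[ml pl] := disjoint_family_pieces abl.
apply/andP; split; first by rewrite all_cat ml ms.
rewrite pairwise_cat pl ps !andbT allrelC.
apply/allrelP => q p qs pp.
have [ap pp' pb] := mem_pieces abl pp.
move: (allP ds _ qs); rewrite /disjoint_pair /= => /orP[bq|qa].
  by rewrite (le_trans pb bq).
by rewrite (le_trans qa ap) orbT.
Qed.

Lemma disjoint_family_catCA s1 s2 s3 :
  disjoint_family (s1 ++ s2 ++ s3) = disjoint_family (s2 ++ s1 ++ s3).
Proof.
have dC p q : disjoint_pair p q = disjoint_pair q p by rewrite /disjoint_pair orbC.
rewrite /disjoint_family !all_cat !pairwise_cat !allrel_catr.
have -> : allrel (@disjoint_pair R) s1 s2 = allrel (@disjoint_pair R) s2 s1.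
  by rewrite allrelC; apply: eq_allrel => p q; rewrite /= dC.
case: (allrel _ s2 s1); last by rewrite !andbF.
move: (all _ s1) (all _ s2) (all _ s3) (pairwise _ s1) (pairwise _ s2).
move: (pairwise _ s3) (allrel _ s1 s3) (allrel _ s2 s3).
by do 8 case.
Qed.

Lemma total_increment_ge0 (h : R -> R) s : 0 <= total_increment h s.
Proof. exact: sumr_ge0. Qed.

(** Replacing some of the intervals of a disjoint family by arbitrarily fine
    partitions keeps it disjoint and does not change its total length; this is
    why the bound on increments is inherited by total variations. *)
Lemma le_total_variation_family (h : R -> R) (e d : R) :
  (forall s, disjoint_family s -> total_length s < d ->
     total_increment h s <= e) ->
  forall A B, disjoint_family (A ++ B) -> total_length (A ++ B) < d ->
  (\sum_(p <- A) total_variation p.1 p.2 h + (total_increment h B)%:E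
     <= e%:E)%E.
Proof.
move=> hed; elim=> [|[a b] A IHA] B dAB lAB.
  by rewrite big_nil add0e lee_fin hed.
rewrite big_cons /=.
have [dAB' lAB'] : disjoint_family (A ++ B) /\ total_length (A ++ B) < d.
  move: dAB lAB; rewrite /disjoint_family /total_length /= big_cons /=.
  move=> /andP[/andP[ab ->] /andP[_ ->]]; split => //; lra.
have ab : a <= b by case/andP: dAB => /= /andP[].
have IHB := IHA _ dAB' lAB'.
have A0 : (0 <= \sum_(p <- A) total_variation p.1 p.2 h)%E.
  rewrite big_seq; apply: sume_ge0 => p pA; apply: total_variation_ge0.
  by case/andP: dAB' => /allP /(_ p); rewrite mem_cat pA => ->.
set X := (\sum_(p <- A) _)%E in IHB A0 *.
have Xfin : X \is a fin_num.
  rewrite ge0_fin_numE//; apply: le_lt_trans (ltry e).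
  by apply: le_trans IHB; rewrite leeDl// lee_fin total_increment_ge0.
rewrite -addeA -leeBrDr; last by rewrite fin_numD Xfin.
apply: ge_ereal_sup => _ /= [_ [l abl <-] <-].
rewrite leeBrDr ?fin_numD ?Xfin//.
rewrite addeCA -EFinD (variation_pieces _ abl).
have -> : total_increment h (pieces a l) + total_increment h B =
    total_increment h (pieces a l ++ B) by rewrite /total_increment big_cat.
have pAB : perm_eq (A ++ (pieces a l ++ B)) (pieces a l ++ (A ++ B)).
  by rewrite perm_catCA.
apply: IHA.
  by rewrite disjoint_family_catCA (disjoint_family_refine abl).
rewrite /total_length (perm_big _ pAB) big_cat/=.
rewrite -/(total_length (pieces a l)) (total_length_pieces abl).
by move: lAB; rewrite /total_length /= big_cons.
Qed.

End pieces_theory.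

Section variation_function.
Context {R : realType}.
Variables (h : R -> R) (a : R).
Hypothesis ach : uniformly_ac h.

Lemma uniformly_ac_bounded_variation b : a <= b ->
  total_variation a b h \is a fin_num.
Proof.
have [d d0 hd] := ach ltr01.
(* An interval shorter than [d] has variation at most 1; [a, b] is covered by
   finitely many steps of length [d / 2]. *)
have step x y : x <= y -> y - x < d -> total_variation x y h \is a fin_num.
  move=> xy yxd; rewrite ge0_fin_numE ?total_variation_ge0//.
  have := @le_total_variation_family _ h 1 d hd [:: (x, y)] [::].
  rewrite /disjoint_family /total_length /total_increment /= xy.
  rewrite !big_cons !big_nil /= addr0 adde0 adde0 => /(_ erefl yxd) /le_lt_trans.
  by apply; exact: ltry.
move=> ab.
have H (n : nat) x : a <= x -> x <= a + n%:R * (d / 2) ->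
    total_variation a x h \is a fin_num.
  elim: n x => [|n IHn] x ax xn.
    have -> : x = a by apply/eqP; rewrite eq_le ax andbT; move: xn; lra.
    by rewrite total_variationxx.
  pose y := Num.max a (x - d / 2).
  have ay : a <= y by rewrite le_max lexx.
  have yx : y <= x by rewrite ge_max ax /=; lra.
  have yxd : x - y < d.
    have : x - d / 2 <= y by rewrite le_max lexx orbT.
    by move: d0; lra.
  rewrite (total_variationD h ay yx) fin_numD (step _ _ yx yxd) andbT.
  apply: IHn => //; rewrite ge_max; apply/andP; split.
    by rewrite lerDl mulr_ge0// divr_ge0 ?ler0n// ltW.
  by move: xn; rewrite -natr1; lra.
apply: (H (Num.bound ((b - a) / (d / 2)))) => //.
rewrite -lerBlDl -ler_pdivrMr; last by lra.
exact/ltW/(le_lt_trans (ler_norm _))/unstable.ltr_norm_bound.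
Qed.

(** The variation of [h] on [a, x], extended by 0 to the left of [a]. *)
Definition variation_from (x : R) : R :=
  fine (total_variation a (Num.max a x) h).

Let maxr_nd x y : x <= y -> Num.max a x <= Num.max a y.
Proof. by move=> xy; rewrite ge_max !le_max lexx xy orbT. Qed.

Let TVfin x y : Num.max a x <= Num.max a y ->
  total_variation (Num.max a x) (Num.max a y) h \is a fin_num.
Proof.
move=> xy; have ay : a <= Num.max a y by rewrite le_max lexx.
have ax : a <= Num.max a x by rewrite le_max lexx.
have := uniformly_ac_bounded_variation ay.
by rewrite (total_variationD h ax xy) fin_numD => /andP[].
Qed.

Lemma variation_fromB x y : x <= y ->
  (variation_from y - variation_from x)%:E =
  total_variation (Num.max a x) (Num.max a y) h.
Proof.
move=> xy; have xy' := maxr_nd xy.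
have ax : a <= Num.max a x by rewrite le_max lexx.
rewrite /variation_from (total_variationD h ax xy') fineD.
- by rewrite addrAC subrr add0r fineK// TVfin.
- exact: uniformly_ac_bounded_variation.
- exact: TVfin.
Qed.

Lemma variation_from_increment x y : a <= x -> x <= y ->
  `|h y - h x| <= variation_from y - variation_from x.
Proof.
move=> ax xy; rewrite -lee_fin variation_fromB//.
rewrite (max_idPr ax) (max_idPr (le_trans ax xy)).
exact: total_variation_ge.
Qed.

Lemma variation_from_nd : {homo variation_from : x y / x <= y}.
Proof.
move=> x y xy; rewrite -subr_ge0 -lee_fin variation_fromB//.
exact/total_variation_ge0/maxr_nd.
Qed.

(** The variation of an absolutely continuous function is absolutely
    continuous. *)
Lemma uniformly_ac_variation_from : uniformly_ac variation_from.
Proof.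
move=> e e0; have [d d0 hd] := ach e0; exists d => // s sd ls.
pose c p := (Num.max a p.1, Num.max a p.2) : R * R.
have cd : disjoint_family (map c s).
  case/andP: sd => ms ps; apply/andP; split.
    by rewrite all_map; apply: sub_all ms => p /= /maxr_nd.
  rewrite pairwise_map; apply: sub_pairwise ps => p q /=.
  by rewrite /disjoint_pair /= => /orP[] /maxr_nd ->//; rewrite orbT.
have cl : total_length (map c s) < d.
  apply: le_lt_trans ls; rewrite /total_length big_map big_seq [leRHS]big_seq.
  apply: ler_sum => p ps.
  have : p.1 <= p.2 by case/andP: sd => /allP/(_ _ ps).
  by rewrite /c /=; case: (leP a p.1); case: (leP a p.2); lra.
have := @le_total_variation_family _ h e d hd (map c s) [::].
rewrite cats0 /total_increment big_nil adde0 => /(_ cd cl).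
rewrite -lee_fin; apply: le_trans.
rewrite -sumEFin big_map big_seq [leRHS]big_seq; apply: lee_sum => p ps.
have pp : p.1 <= p.2 by case/andP: sd => /allP/(_ _ ps).
by rewrite ger0_norm ?subr_ge0 ?variation_from_nd// variation_fromB.
Qed.

End variation_function.

(** * Null sets and Stieltjes measures *)

Lemma uniformly_ac_continuous (R : realType) (h : R -> R) :
  uniformly_ac h -> continuous h.
Proof.
move=> ach x; apply/cvgrPdist_le => e e0.
have [d d0 hd] := ach _ e0.
near=> y.
have xyd : `|x - y| < d by near: y; exact: cvgr_dist_lt.
have H u v : u <= v -> v - u < d -> `|h v - h u| <= e.
  move=> uv vu; have := hd [:: (u, v)].
  rewrite /disjoint_family /total_length /total_increment !big_seq1 /= uv.
  exact.
case: (leP x y) => [xy|/ltW yx].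
  rewrite distrC; apply: H => //.
  by move: xyd; rewrite distrC ger0_norm// subr_ge0.
by apply: H => //; move: xyd; rewrite ger0_norm// subr_ge0.
Unshelve. all: by end_near. Qed.

Lemma lebesgue_stieltjes_measure_oc (R : realType) (W : cumulative R R)
    (x y : R) : x <= y ->
  lebesgue_stieltjes_measure W `]x, y]%classic = (W y - W x)%:E.
Proof.
move=> xy; rewrite /lebesgue_stieltjes_measure /measure_extension.
by rewrite measurable_mu_extE/= ?wlength_itv_bnd//; exact: is_ocitv.
Qed.

(** An interval of finite measure, of any of the possible shapes, lies between
    an open and a closed bounded interval with the same end points. *)
Lemma finite_itv_hull (R : realType) (I : set R) : is_interval I ->
  (lebesgue_measure I < +oo)%E ->
  exists lr : R * R, [/\ lr.1 <= lr.2, `]lr.1, lr.2[ `<=` I, I `<=` `[lr.1, lr.2]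
    & lebesgue_measure I = (lr.2 - lr.1)%:E].
Proof.
move=> iI; rewrite -(@RhullK _ I) ?inE// lebesgue_measure_itv.
case: (Rhull I) => [[b l|b] [c r|c]] //=; last 3 first.
- case: c => /=; last by rewrite ltry addye ?ltxx.
  move=> _; exists (0, 0); split => //=; last by rewrite subrr.
    by rewrite set_itv_ge ?bnd_simp ?ltxx.
  by move=> x /=; rewrite ?in_itv /= ?andbF.
- case: b => /=; first by rewrite ltNyr addey ?ltxx.
  move=> _; exists (0, 0); split => //=; last by rewrite subrr.
    by rewrite set_itv_ge ?bnd_simp ?ltxx.
- move=> bc; exists (0, 0); split => /=.
  + exact: lexx.
  + by rewrite set_itv_ge ?bnd_simp ?ltxx.
  + by move: bc; case: b; case: c => //= _ x /=; rewrite ?in_itv /= ?andbF.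
  + by rewrite subrr; move: bc; case: b; case: c; rewrite /= ?ltxx ?ltNyy ?addey ?ltxx.
rewrite lte_fin; have [lr _|rl _] := ltrP l r.
  exists (l, r); split => /=.
  - by rewrite ltW.
  - by apply: subset_itv; rewrite bnd_simp; case: b.
  - by apply: subset_itv; rewrite bnd_simp; case: c.
  - by rewrite EFinB.
exists (l, l); split => /=.
- exact: lexx.
- by rewrite set_itv_ge ?bnd_simp ?ltxx.
- move=> x /=; rewrite !in_itv /= => /andP[lx xr].
  have {}lx : l <= x by case: b lx => // /ltW.
  have {}xr : x <= r by case: c xr => // /ltW.
  by rewrite lx (le_trans xr rl).
- by rewrite subrr.
Qed.

Lemma null_open_cover (R : realType) (A : set R) (d : R) : 0 < d ->
  measurable A -> lebesgue_measure A = 0%E ->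
  exists U : set R, [/\ open U, A `<=` U & (lebesgue_measure U < d%:E)%E].
Proof.
move=> d0 mA A0.
have A1 : (lebesgue_measure A < +oo)%E by rewrite A0 ltry.
have [U [oU AU Ud]] := lebesgue_regularity_outer mA A1 d0.
exists U; split => //; have mU := open_measurable oU.
rewrite -(setDUK AU) measureU//; last 2 first.
  exact: measurableD.
  by rewrite setDIK.
by rewrite [X in (X + _)%E](_ : _ = 0%E) ?add0e.
Qed.

(** A null set lies in an open set of small measure; the components of the
    latter form a disjoint family of small total length, on which an
    absolutely continuous [W] has small total increment. *)
Lemma uniformly_ac_dominates (R : realType) (W : cumulative R R) (A : set R) :
  uniformly_ac W -> measurable A -> lebesgue_measure A = 0%E ->
  lebesgue_stieltjes_measure W A = 0%E.
Proof.
move=> acW mA A0; apply/eqP; rewrite eq_le measure_ge0 andbT.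
apply/lee_addgt0Pr => e e0; rewrite add0e.
have [d d0 Wd] := acW _ e0.
have [U [oU AU Ud]] := null_open_cover d0 mA A0.
have mU := open_measurable oU.
pose J := open_disjoint_itv oU.
have oI i : open (J i) by exact: open_disjoint_itv_open.
have mI i : measurable (J i) by exact: open_measurable.
have UI : U = \bigcup_i J i by exact: open_disjoint_itv_bigcup.
have tI : trivIset setT J by exact: open_disjoint_itv_trivIset.
have lI i : (lebesgue_measure (J i) < +oo)%E.
  apply: le_lt_trans (lt_trans Ud (ltry d)).
  apply: le_measure; rewrite ?inE; [exact: mI|exact: mU|].
  by rewrite [X in _ `<=` X]UI; exact: bigcup_sup.
have /choice[lr lrP] := fun i =>
  finite_itv_hull (@open_disjoint_itv_is_interval _ _ oU i) (lI i).
have Ilr i : J i `<=` `](lr i).1, (lr i).2].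
  have [_ _ JI _] := lrP i; move=> x /[dup] Jx /JI /=.
  rewrite !in_itv /= => /andP[lx ->]; rewrite andbT lt_neqAle lx andbT.
  apply/eqP => xl; have /= [e' /= e'0 eJ] := open_nbhs_nbhs (conj (oI i) Jx).
  have /JI : J i (x - e' / 2).
    by apply: eJ; rewrite /ball_ /= opprB addrC subrK gtr0_norm; lra.
  by rewrite /= in_itv /= xl; lra.
have measUJ (m : {measure set (measurableTypeR R) -> \bar R}) :
    m U = (\sum_(0 <= i <oo) m (J i))%E.
  rewrite [X in m X]UI measure_bigcup//; last by move=> i _; exact: mI.
  by apply: eq_eseriesl => i; rewrite in_setT.
apply: (@le_trans _ _ (lebesgue_stieltjes_measure W U)).
  by apply: le_measure; rewrite ?inE//; exact: mU.
rewrite measUJ; apply: lime_le; first exact: is_cvg_nneseries.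
apply: nearW => n.
(* Empty components are dropped: only the nondegenerate ones are sure to be
   disjoint as intervals of end points [lr i]. *)
pose s := [seq lr i | i <- iota 0 n & (lr i).1 < (lr i).2].
have sd : disjoint_family s.
  apply/andP; split.
    by apply/allP => _ /mapP[i _ ->]; case: (lrP i).
  rewrite pairwise_map.
  apply: (@sub_in_pairwise _ (fun i => (lr i).1 < (lr i).2) (fun i j => i != j)).
  - move=> i j; rewrite -!topredE /= => ii jj ij.
    rewrite /disjoint_pair; apply/negPn/negP; rewrite negb_or -!ltNge.
    move=> /andP[h1 h2].
    pose l := Num.max (lr i).1 (lr j).1; pose r := Num.min (lr i).2 (lr j).2.
    have lr' : l < r by rewrite lt_min !gt_max ii jj h1 h2.
    move/trivIsetP : tI => /(_ i j I I ij); rewrite -subset0 => /(_ ((l + r) / 2)).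
    have [l1 l2] : (lr i).1 <= l /\ (lr j).1 <= l by rewrite !le_max !lexx orbT.
    have [r1 r2] : r <= (lr i).2 /\ r <= (lr j).2 by rewrite !ge_min !lexx orbT.
    apply; split; [have [_ + _ _] := lrP i|have [_ + _ _] := lrP j]; apply;
      rewrite /= in_itv /=; apply/andP; split; lra.
  - by apply/allP => i; rewrite mem_filter => /andP[].
  - by rewrite -uniq_pairwise filter_uniq// iota_uniq.
have sum_s (F : R * R -> R) : (forall p, p.1 = p.2 -> F p = 0) ->
    \sum_(p <- s) F p = \sum_(0 <= i < n) F (lr i).
  move=> F0; rewrite /s big_map big_filter /index_iota subn0.
  rewrite [RHS](bigID (fun i => (lr i).1 < (lr i).2)) /=.
  rewrite [X in _ + X]big1 ?addr0// => i; rewrite -leNgt => h.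
  by apply: F0; apply/eqP; rewrite eq_le h andbT; case: (lrP i).
have sl : total_length s < d.
  rewrite /total_length sum_s; last by move=> p ->; rewrite subrr.
  rewrite -lte_fin; apply: le_lt_trans Ud.
  rewrite measUJ -sumEFin; apply: (@le_trans _ _
      (\sum_(0 <= i < n) lebesgue_measure (J i))%E); last first.
    by apply: nneseries_lim_ge => i _ _; exact: measure_ge0.
  by apply: lee_sum => i _; have [_ _ _ ->] := lrP i.
have := Wd s sd sl; rewrite -lee_fin; apply: le_trans.
rewrite /total_increment sum_s; last by move=> p ->; rewrite subrr normr0.
rewrite -sumEFin.
apply: lee_sum => i _; have [lri _ _ _] := lrP i.
apply: (@le_trans _ _ (lebesgue_stieltjes_measure W `](lr i).1, (lr i).2]%classic)).
  by apply: le_measure; rewrite ?inE//; exact: mI.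
by rewrite lebesgue_stieltjes_measure_oc// lee_fin ler_norm.
Qed.

(** * Almost everywhere derivatives *)

(** The density is the Radon-Nikodym derivative of the Stieltjes measure of
    [W]. *)
Lemma uniformly_ac_nd_density (R : realType) (W : R -> R) (a b : R) :
  {homo W : x y / x <= y} -> uniformly_ac W -> a < b ->
  exists2 rho : R -> R, lebesgue_measure.-integrable setT (EFin \o rho) &
    forall x, a <= x <= b ->
      W x - W a = (\int[lebesgue_measure]_(s in `]a, x]) rho s)%R.
Proof.
move=> ndW acW ab.
have rcW := @right_continuousW R _ R W (uniformly_ac_continuous acW).
pose f : cumulative R R := HB.pack W (isCumulative.Build R _ R W ndW rcW).
have mD : measurable (`]a, b]%classic : set (measurableTypeR R)) by [].
have fD : (lebesgue_stieltjes_measure f `]a, b]%classic < +oo)%E.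
  by rewrite lebesgue_stieltjes_measure_oc ?ltry// ltW.
pose nu : {finite_measure set (measurableTypeR R) -> \bar R} := mfrestr mD fD.
have nul : nu `<< (@lebesgue_measure R).
  apply/null_content_dominatesP => A mA A0; rewrite /= /mfrestr /mrestr.
  apply: uniformly_ac_dominates => //; first exact: measurableI.
  apply: (@subset_measure0 _ _ _ _ _ A) => //; exact: measurableI.
have [g [g0 gfin gint gE]] := radon_nikodym_sigma_finite nul.
exists (fine \o g).
  by apply: eq_integrable gint => // x _; rewrite /= fineK.
move=> x /andP[ax xb]; rewrite /Rintegral.
rewrite (eq_integral g); last by move=> y _; rewrite /= fineK.
rewrite -gE// /= /mfrestr /mrestr setIidl; last first.
  by apply: subset_itv; rewrite bnd_simp.
by rewrite lebesgue_stieltjes_measure_oc.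
Qed.

(** The fundamental theorem of calculus for absolutely continuous functions: [h]
    is the difference of the nondecreasing functions [V + h] and [V], where [V]
    is its variation. *)
Lemma uniformly_ac_derivative (R : realType) (h : R -> R) (a b : R) :
  uniformly_ac h -> a < b ->
  exists rho : R -> R,
  [/\ lebesgue_measure.-integrable setT (EFin \o rho),
      forall x, a <= x <= b ->
        h x - h a = (\int[lebesgue_measure]_(s in `]a, x]) rho s)%R &
      {ae lebesgue_measure, forall x : R, a < x < b ->
        derivable h x 1 /\ derive1 h x = rho x}].
Proof.
move=> ach ab; pose V := variation_from h a.
have ndV : {homo V : x y / x <= y} by exact: variation_from_nd.
have acV : uniformly_ac V by exact: uniformly_ac_variation_from.
pose W x := V x + h (Num.max a x).
have incW x y : x <= y -> `|h (Num.max a y) - h (Num.max a x)| <= V y - V x.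
  move=> xy.
  have -> : V y - V x = V (Num.max a y) - V (Num.max a x).
    by rewrite /V /variation_from !maxA !maxxx.
  apply: variation_from_increment => //; first by rewrite le_max lexx.
  by rewrite ge_max !le_max lexx xy orbT.
have ndW : {homo W : x y / x <= y}.
  by move=> x y xy; have := incW _ _ xy; rewrite /W ler_norml; lra.
have acW : uniformly_ac W.
  move=> e e0; have e2 : 0 < e / 2 by lra.
  have [d d0 Vd] := acV _ e2; exists d => // s sd sl.
  have := Vd s sd sl; rewrite /total_increment => Ve.
  have : \sum_(p <- s) `|W p.2 - W p.1| <= \sum_(p <- s) 2 * `|V p.2 - V p.1|.
    rewrite big_seq [leRHS]big_seq; apply: ler_sum => p ps.
    have pp : p.1 <= p.2 by case/andP: sd => /allP/(_ _ ps).
    have := incW _ _ pp; rewrite ler_norml => /andP[].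
    rewrite ger0_norm ?subr_ge0 ?ndW// ger0_norm ?subr_ge0 ?ndV// /W; lra.
  by rewrite -mulr_sumr; lra.
have [r1 r1i r1E] := uniformly_ac_nd_density ndV acV ab.
have [r2 r2i r2E] := uniformly_ac_nd_density ndW acW ab.
pose rho x := r2 x - r1 x.
have irho : lebesgue_measure.-integrable setT (EFin \o rho).
  by have := integrableB measurableT r2i r1i; apply: eq_integrable.
have hE x : a <= x <= b ->
    h x - h a = (\int[lebesgue_measure]_(s in `]a, x]) rho s)%R.
  move=> /andP[ax xb]; rewrite RintegralB//; last 2 first.
    exact: integrableS r2i.
    exact: integrableS r1i.
  rewrite -r1E ?ax// -r2E ?ax// /W (max_idPr ax) maxxx; lra.
exists rho; split => //.
have irhoy y : lebesgue_measure.-integrable `]a, y] (EFin \o rho).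
  exact: integrableS irho.
have := FTC1 irhoy (open_integrable_locally openT irho).
apply: filterS; first exact: (ae_filter_ringOfSetsType lebesgue_measure).
move=> x + /andP[ax xb].
move=> /(_ ax)[dF F'].
pose F y := (\int[lebesgue_measure]_(t in `]a, y]) rho t)%R.
have hF : {near x, (fun y => h a + F y) =1 h}.
  near=> y; have ay : a <= y by apply/ltW; near: y; exact: lt_nbhsr.
  have yb : y <= b by apply/ltW; near: y; exact: lt_nbhsl.
  by rewrite /F -hE ?ay// addrC subrK.
have dhF : is_derive x 1 (fun y => h a + F y) (rho x).
  rewrite -F' derive1E -[X in is_derive _ _ _ X]add0r.
  by apply: is_deriveD; apply: derivableP.
have [hx hx'] := near_eq_is_derive hF dhF.
by split => //; rewrite derive1E.
Unshelve. all: by end_near. Qed.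

(** * Row vectors and curves of row vectors *)

(** Comparison of the Euclidean norm [enorm] with the maximum norm. The factors
    [n] are not optimal. *)
Section row_norms.
Context {R : realType} {n : nat}.
Implicit Types (x y : 'rV[R]_n).

Lemma coord_le_norm x i : `|x 0 i| <= `|x|.
Proof.
rewrite [leRHS]/Num.Def.normr/= mx_normrE.
exact: (le_bigmax _ (fun ij : 'I_1 * 'I_n => `|x ij.1 ij.2|) (0, i)).
Qed.

Lemma norm_le_coord x (c : R) : 0 <= c -> (forall i, `|x 0 i| <= c) -> `|x| <= c.
Proof.
move=> c0 xc; rewrite [leLHS]/Num.Def.normr/= mx_normrE.
by apply: bigmax_le => // -[i j] _ /=; rewrite ord1.
Qed.

Lemma dotr_ge0 x : 0 <= dotr x x.
Proof. by apply: sumr_ge0 => i _; rewrite -expr2 sqr_ge0. Qed.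

Lemma sqr_enorm x : enorm x ^+ 2 = dotr x x.
Proof. by rewrite sqr_sqrtr// dotr_ge0. Qed.

Lemma enorm_ge0 x : 0 <= enorm x. Proof. exact: sqrtr_ge0. Qed.

Lemma coord_le_enorm x i : `|x 0 i| <= enorm x.
Proof.
rewrite -sqrtr_sqr; apply: ler_wsqrtr; rewrite /dotr (bigD1 i)//= -expr2 lerDl.
by apply: sumr_ge0 => j _; rewrite -expr2 sqr_ge0.
Qed.

Lemma norm_le_enorm x : `|x| <= enorm x.
Proof. by apply: norm_le_coord; [exact: enorm_ge0|exact: coord_le_enorm]. Qed.

Lemma enorm_le_norm x : enorm x <= n%:R * `|x|.
Proof.
rewrite -[leRHS]ger0_norm ?mulr_ge0// -sqrtr_sqr; apply: ler_wsqrtr.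
rewrite /dotr; apply: (@le_trans _ _ (\sum_(i < n) `|x| ^+ 2)).
  apply: ler_sum => i _; rewrite -expr2 -[leLHS]ger0_norm ?sqr_ge0//.
  by rewrite normrX lerXn2r ?nnegrE// coord_le_norm.
rewrite sumr_const card_ord exprMn -[leLHS]mulr_natl ler_wpM2r ?sqr_ge0//.
by rewrite -natrX ler_nat; case: n => // m; rewrite -mulnn leq_pmull.
Qed.

Lemma dotr_le (a : R) x y : enorm x <= a -> `|dotr x y| <= n%:R * a * enorm y.
Proof.
move=> xa; apply: le_trans (ler_norm_sum _ _ _) _.
apply: (@le_trans _ _ (\sum_(i < n) a * enorm y)).
  apply: ler_sum => i _; rewrite normrM ler_pM//; last exact: coord_le_enorm.
  exact: le_trans (coord_le_enorm _ _) xa.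
by rewrite sumr_const card_ord -mulrA [leRHS]mulr_natl.
Qed.

End row_norms.

Lemma cvg_rowP (R : realType) (n : nat) (I : Type) (F : set_system I)
    (FF : Filter F) (u : I -> 'rV[R]_n) (l : 'rV[R]_n) :
  (forall i, u k 0 i @[k --> F] --> l 0 i) -> u @ F --> l.
Proof.
move=> ul; apply/cvgrPdist_le => e e0.
have : \forall k \near F, forall i, `|l 0 i - u k 0 i| <= e.
  by apply: filter_forall => i; exact: (cvgrPdist_le _ _).1 (ul i) _ e0.
apply: filterS => k ke; apply: norm_le_coord; first exact: ltW.
by move=> i; rewrite !mxE.
Qed.

(** The nearest point of [0, T]. *)
Definition clamp (R : realType) (T s : R) : R := Num.max 0 (Num.min T s).

Section clamp_theory.
Context {R : realType}.
Variables (T : R).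
Hypothesis T0 : 0 <= T.

Lemma clamp_itv s : 0 <= clamp T s <= T.
Proof. by rewrite /clamp le_max lexx /= ge_max T0 ge_min lexx. Qed.

Lemma clamp_nd : {homo clamp T : x y / x <= y}.
Proof.
move=> x y xy; rewrite /clamp ge_max !le_max lexx /= !le_min !ge_min lexx xy.
by rewrite /= !orbT.
Qed.

Lemma clamp_id s : 0 <= s <= T -> clamp T s = s.
Proof. by move=> /andP[s0 sT]; rewrite /clamp (min_idPr sT) (max_idPr s0). Qed.

Lemma clampB x y : x <= y -> clamp T y - clamp T x <= y - x.
Proof.
rewrite /clamp => xy; case: (leP T x) => ?; case: (leP T y) => ?;
  case: (leP 0 x) => ?; case: (leP 0 y) => ?; case: (leP 0 T) => ?; lra.
Qed.

Lemma clamp_continuous : continuous (clamp T).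
Proof.
move=> x; apply: continuous_max; first exact: cvg_cst.
by apply: continuous_min; [exact: cvg_cst|exact: cvg_id].
Qed.

End clamp_theory.

(** Composing with [clamp T] extends the curve by constants outside [0, T]. *)
Lemma absolutely_continuous_coord (R : realType) (n : nat) (T : R)
    (gamma : R -> 'rV[R]_n) (i : 'I_n) :
  0 <= T -> absolutely_continuous 0 T gamma ->
  uniformly_ac (fun s => gamma (clamp T s) 0 i).
Proof.
move=> T0 acg e e0; have [d d0 gd] := acg e e0; exists d => // s /andP[ms ps] sl.
pose p (k : 'I_(size s)) := nth (0, 0) s k.
have pord k : (p k).1 <= (p k).2 by apply: (allP ms); exact: mem_nth.
have big_s (F : R * R -> R) : \sum_(q <- s) F q = \sum_(k < size s) F (p k).
  by rewrite (big_nth (0, 0)) big_mkord.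
have := gd (size s) (fun k => clamp T (p k).1) (fun k => clamp T (p k).2).
move=> /(_ _ _ _)/ltW; rewrite /total_increment big_s.
move=> H; apply: le_trans (H _ _ _) => {H}.
- apply: ler_sum => k _.
  by have := coord_le_enorm (gamma (clamp T (p k).2) - gamma (clamp T (p k).1)) i; rewrite !mxE.
- move=> k; have /andP[-> _] := clamp_itv T0 (p k).1.
  by have /andP[_ ->] := clamp_itv T0 (p k).2; rewrite clamp_nd.
- have disj (j k : 'I_(size s)) : (j < k)%N ->
      `](clamp T (p j).1), (clamp T (p j).2)[ `&`
      `](clamp T (p k).1), (clamp T (p k).2)[ = set0.
    move=> jk; rewrite -subset0 => x /= []; rewrite !in_itv /=.
    move=> /andP[j1 j2] /andP[k1 k2].
    have /(_ _ _ _ _ jk) := pairwiseP (0, 0) ps; rewrite -!topredE /=.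
    move=> /(_ (ltn_ord _) (ltn_ord _)); rewrite /disjoint_pair -/(p j) -/(p k).
    by move=> /orP[] /(clamp_nd T); lra.
  apply/trivIsetP => j k _ _; rewrite neq_ltn => /orP[] jk; first exact: disj.
  by rewrite setIC; exact: disj.
- apply: le_lt_trans sl; rewrite /total_length big_s.
  by apply: ler_sum => k _; apply: clampB.
Qed.

Lemma ae_null_set (R : realType) (P : R -> Prop) :
  {ae lebesgue_measure, forall x : R, P x} ->
  exists2 N : set R, measurable N /\ lebesgue_measure N = 0%E &
    forall x, ~ N x -> P x.
Proof.
move=> [N [mN N0 PN]]; exists N => // x Nx.
by apply: contrapT => Px; apply: Nx; apply: PN.
Qed.

Lemma absolutely_continuous_derivative (R : realType) (n : nat) (T : R)
    (gamma : R -> 'rV[R]_n) :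
  0 < T -> absolutely_continuous 0 T gamma ->
  exists (N : set R) (w : 'I_n -> R -> R),
  [/\ measurable N /\ lebesgue_measure N = 0%E,
      forall i, lebesgue_measure.-integrable setT (EFin \o w i),
      forall s, 0 < s < T -> ~ N s ->
        derivable gamma s 1 /\ forall i, (derive1 gamma s) 0 i = w i s &
      forall i x y, 0 <= x -> x <= y -> y <= T ->
        gamma y 0 i - gamma x 0 i =
        (\int[lebesgue_measure]_(s in `]x, y]) w i s)%R].
Proof.
move=> T0 acg; have T0' := ltW T0.
have /choice[w wP] := fun i =>
  uniformly_ac_derivative (absolutely_continuous_coord i T0' acg) T0.
have clampT x : 0 <= x <= T -> clamp T x = x by exact: clamp_id.
have /ae_null_set[N N0 NP] : {ae lebesgue_measure, forall x : R, forall i,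
    0 < x < T -> derivable (fun s => gamma (clamp T s) 0 i) x 1 /\
    derive1 (fun s => gamma (clamp T s) 0 i) x = w i x}.
  have FF := ae_filter_ringOfSetsType (@lebesgue_measure R).
  by apply: filter_forall => i; have [_ _] := wP i.
exists N, w; split => //.
- by move=> i; have [] := wP i.
- move=> s sT Ns.
  have nearg i : {near s, (fun s => gamma (clamp T s) 0 i) =1 (fun s => gamma s 0 i)}.
    have /andP[s0 s1] := sT; near=> r; rewrite clampT//; apply/andP; split.
      by apply/ltW; near: r; exact: lt_nbhsr.
    by apply/ltW; near: r; exact: lt_nbhsl.
  have dg : derivable gamma s 1.
    apply/derivable_mxP => i j; rewrite ord1.
    exact: near_eq_derivable (nearg j) (NP s Ns j sT).1.
  split => // i; rewrite derive1E derive_mx// mxE.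
  rewrite -(NP s Ns i sT).2 derive1E; apply/esym.
  exact: near_eq_derive (nearg i).
- move=> i x y x0 xy yT; have [wi wE _] := wP i.
  have E z : 0 <= z <= T -> gamma z 0 i - gamma 0 0 i =
      (\int[lebesgue_measure]_(s in `]0%R, z]) w i s)%R.
    by move=> zT; rewrite -wE// !clampT// lexx.
  rewrite -(@Rintegral_itvB _ _ (BRight 0) (BRight y) x) ?bnd_simp//.
    rewrite -!E ?x0 ?(le_trans xy yT) ?(le_trans x0 xy)//; lra.
  exact: integrableS wi.
Unshelve. all: by end_near. Qed.

(** Only the values of [f] on [A] are constrained, hence the assumption that [u]
    takes its values in [A]. *)
Lemma within_continuous_comp (X Y Z : topologicalType) (A : set Y) (f : Y -> Z)
    (F : set_system X) (FF : Filter F) (u : X -> Y) (y : Y) :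
  {within A, continuous f} -> A y -> (forall x, A (u x)) -> u @ F --> y ->
  (f \o u) @ F --> f y.
Proof.
move=> cf Ay Au uy.
have cfy : f @ (within A (nbhs y)) --> f y.
  by rewrite (nbhs_subspace_in Ay); exact: cf.
apply: cvg_comp cfy => P; rewrite /within /= => /uy.
by move=> h; rewrite /nbhs /= in h *; apply: filterS h => x; exact.
Qed.

Lemma cvg_prod (X : Type) (Y Z : topologicalType) (F : set_system X)
    (FF : Filter F) (u : X -> Y) (v : X -> Z) (y : Y) (z : Z) :
  u @ F --> y -> v @ F --> z -> (fun x => (u x, v x)) @ F --> ((y, z) : Y * Z).
Proof. by move=> uy vz; exact: cvg_pair. Qed.

(** Almost everywhere, [Phi] along the curve is the limit of the continuous
    functions obtained by replacing the derivative by difference quotients. *)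
Lemma measurable_along_curve (R : realType) (n : nat) (T : R)
    (U : set 'rV[R]_n) (N : set R) (gamma : R -> 'rV[R]_n)
    (Phi : R * 'rV[R]_n * 'rV[R]_n -> R) :
  0 < T -> absolutely_continuous 0 T gamma ->
  (forall s, 0 <= s <= T -> U (gamma s)) -> measurable N ->
  (forall s, 0 < s < T -> ~ N s -> derivable gamma s 1) ->
  {within `[0, T]%classic `*` U `*` setT, continuous Phi} ->
  exists2 F : R -> R, measurable_fun setT F &
    forall s, 0 < s < T -> ~ N s -> F s = Phi (s, gamma s, derive1 gamma s).
Proof.
move=> T0 acg gU mN dg cPhi; have T0' := ltW T0.
pose gc s := gamma (clamp T s).
have cgc : continuous gc.
  move=> s; apply: cvg_rowP => i.
  exact: (uniformly_ac_continuous (absolutely_continuous_coord i T0' acg)).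
pose q (k : nat) s := k.+1%:R *: (gc (s + k.+1%:R^-1) - gc s).
have cq k : continuous (q k).
  move=> s; apply: cvgZr; apply: cvgB; last exact: cgc.
  apply: (@cvg_comp _ _ _ (fun s => s + k.+1%:R^-1) gc _
    (nbhs (s + k.+1%:R^-1))); last exact: cgc.
  by apply: cvgD; [exact: cvg_id|exact: cvg_cst].
pose u k s := (clamp T s, gc s, q k s).
have Au k s : (`[0, T]%classic `*` U `*` setT) (u k s).
  by split => //; split => /=; [rewrite in_itv /= clamp_itv|apply/gU/clamp_itv].
pose E := `]0, T[ `\` N.
have mE : measurable E by exact: measurableD.
pose F s := Phi (s, gamma s, derive1 gamma s) * \1_E s.
exists F; last first.
  move=> s sT Ns; have sE : E s by split => //=; rewrite in_itv.
  by rewrite /F indicE mem_set// mulr1.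
apply: (@measurable_fun_cvg _ _ _ _ (fun k s => Phi (u k s) * \1_E s)).
  move=> k; apply: measurable_funM; last exact: measurable_indic.
  apply: continuous_measurable_fun => s.
  apply: (@within_continuous_comp _ _ _ _ Phi _ _ (u k) (u k s) cPhi) => //.
  apply: cvg_prod; last exact: cq.
  by apply: cvg_prod; [exact: clamp_continuous|exact: cgc].
move=> s _; rewrite /F; have [sE|sE] := boolP (s \in E); last first.
  rewrite indicE (negbTE sE) mulr0; under eq_fun do rewrite mulr0.
  exact: cvg_cst.
apply: cvgM; last exact: cvg_cst.
have [sT Ns] : 0 < s < T /\ ~ N s by move: sE; rewrite inE => -[]; rewrite /= in_itv.
have sT' : clamp T s = s by apply: clamp_id; case/andP: sT => /ltW -> /ltW ->.
have gcs : gc s = gamma s by rewrite /gc sT'.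
apply: (@within_continuous_comp _ _ _ _ Phi _ _ (u ^~ s) (s, gamma s, derive1 gamma s) cPhi) => //.
  by split => //; split => /=; [rewrite in_itv /=; case/andP: sT => /ltW -> /ltW ->|
    rewrite -gcs; apply/gU/clamp_itv].
apply: cvg_prod; first by rewrite /u sT' gcs; exact: cvg_cst.
have nearg : {near s, gamma =1 gc}.
  have /andP[s0 s1] := sT; near=> r; rewrite /gc clamp_id//; apply/andP; split.
    by apply/ltW; near: r; exact: lt_nbhsr.
  by apply/ltW; near: r; exact: lt_nbhsl.
have dgc := near_eq_derivable nearg (dg s sT Ns).
have -> : derive1 gamma s = 'D_1 gc s by rewrite derive1E; exact: near_eq_derive.
have : h^-1 *: (gc (h *: 1 + s) - gc s) @[h --> 0^'] --> 'D_1 gc s by exact: dgc.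
have hd : (@harmonic R) @ \oo --> (0 : R)^'.
  move=> P P0; have : nbhs (0 : R) (fun y => y != 0 -> P y) by exact: P0.
  move=> /cvg_harmonic h; rewrite /nbhs /= in h *; apply: filterS h => k hk.
  by apply: hk; rewrite /harmonic invr_neq0.
move=> /(cvg_comp _ _ hd); apply: cvg_trans; apply: near_eq_cvg; apply: nearW => k.
by rewrite /= /harmonic /u /q /= invrK [_%:A]mulr1 (addrC s).
Unshelve. all: by end_near. Qed.

(** * Integrals *)

Section integral_off_null_set.
Local Open Scope ereal_scope.
Context d (T : measurableType d) (R : realType).
Variable mu : {measure set T -> \bar R}.
Implicit Types (f g : T -> \bar R) (D N : set T).

Import HBNNSimple.

Let le_nnintegral N f g : measurable N -> mu N = 0 ->
  (forall x, 0 <= g x) -> (forall x, ~ N x -> f x <= g x) ->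
  ereal_sup [set sintegral mu h |
    h in [set h : {nnsfun T >-> R} | forall x, (h x)%:E <= f x]] <=
  ereal_sup [set sintegral mu h |
    h in [set h : {nnsfun T >-> R} | forall x, (h x)%:E <= g x]].
Proof.
move=> mN N0 g0 fg; apply: ge_ereal_sup => _ /= [h hf <-].
have mN' : measurable (~` N) by exact: measurableC.
pose h' := proj_nnsfun h mN'.
have h'E x : h' x = (h \_ (~` N)) x by rewrite (mrestrict h mN').
apply: ereal_sup_ubound => /=; exists h'.
  move=> x; rewrite h'E /patch; case: ifPn => [/set_mem Nx|_].
    exact: le_trans (hf x) (fg x Nx).
  exact: g0.
rewrite -!integralT_nnsfun; apply: ge0_ae_eq_integral => //.
- exact/measurable_EFinP.
- exact/measurable_EFinP.
- by move=> x _; rewrite lee_fin.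
- by move=> x _; rewrite lee_fin.
exists N; split => // x /=; apply: contra_notP => Nx _.
by rewrite mindicE mem_set// mulr1.
Qed.

(** Neither the functions nor the domains need be measurable: the integral is
    a difference of two suprema over simple functions, and a simple function
    may be replaced by 0 on a null set without changing its integral. *)
Lemma le_integral_off_null_set D1 D2 N f g : measurable N -> mu N = 0 ->
  (forall x, ~ N x -> (f \_ D1) x <= (g \_ D2) x) ->
  \int[mu]_(x in D1) f x <= \int[mu]_(x in D2) g x.
Proof.
move=> mN N0 fg; rewrite /integral; apply: leeB.
  apply: (le_nnintegral mN N0) => [x|x Nx]; first exact: funepos_ge0.
  apply: (@funepos_le _ _ (~` N)); last exact/mem_set.
  by move=> y /set_mem; exact: fg.
apply: (le_nnintegral mN N0) => [x|x Nx]; first exact: funeneg_ge0.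
apply: (@funeneg_le _ _ (~` N)); last exact/mem_set.
by move=> y /set_mem; exact: fg.
Qed.

Lemma eq_integral_off_null_set D1 D2 N f g : measurable N -> mu N = 0 ->
  (forall x, ~ N x -> (f \_ D1) x = (g \_ D2) x) ->
  \int[mu]_(x in D1) f x = \int[mu]_(x in D2) g x.
Proof.
move=> mN N0 fg; apply/eqP; rewrite eq_le; apply/andP.
by split; apply: (le_integral_off_null_set mN N0) => x /fg ->.
Qed.

End integral_off_null_set.

Lemma integrable_bounded_below d (T : measurableType d) (R : realType)
    (mu : {measure set T -> \bar R}) (D : set T) (f : T -> R) (c : R) :
  measurable D -> (mu D < +oo)%E -> measurable_fun D f ->
  (forall x, D x -> - c <= f x) ->
  (\int[mu]_(x in D) (f x)%:E < +oo)%E -> mu.-integrable D (EFin \o f).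
Proof.
move=> mD muD mf cf; have mf' : measurable_fun D (EFin \o f) by exact/measurable_EFinP.
have negfin : (\int[mu]_(x in D) ((EFin \o f)^\- x) < +oo)%E.
  apply: (@le_lt_trans _ _ (\int[mu]_(x in D) (`|c|%:E))%E).
    apply: ge0_le_integral => //.
    - exact: measurable_funeneg.
    - move=> x Dx; rewrite funenegE /= -EFin_max lee_fin ge_max normr_ge0 andbT.
      by have := cf x Dx; have := ler_norm c; lra.
  by rewrite integral_cst// lte_mul_pinfty// lee_fin.
rewrite integralE => fint; apply/integrableP; split => //.
have -> : (fun x => `|(EFin \o f) x|)%E = ((EFin \o f)^\+ \+ (EFin \o f)^\-)%E.
  by rewrite -fune_abse.
rewrite ge0_integralD//; last 2 first.
  exact: measurable_funepos.
  exact: measurable_funeneg.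
apply: lte_add_pinfty => //.
move: fint; set p := (\int[mu]_(x in D) _^\+ x)%E; set q := (\int[mu]_(x in D) _^\- x)%E.
rewrite -/q in negfin; move: negfin.
have : (0 <= q)%E by apply: integral_ge0.
by case: p => [p'||]; rewrite ?ltry ?ltNyr//; case: q => [r||]//; rewrite ?addye ?ltxx.
Qed.

Section affine_change_of_variable.
Context {R : realType}.
Variables (k c : R).
Hypothesis k0 : 0 < k.
Let theta (s : R) : R := k * s + c.
Local Notation mu := (@lebesgue_measure R).

Let mtheta : measurable_fun setT (theta : measurableTypeR R -> measurableTypeR R).
Proof.
apply: continuous_measurable_fun => s.
by apply: cvgD; [apply: cvgM; [exact: cvg_cst|exact: cvg_id]|exact: cvg_cst].
Qed.

Lemma measurable_affine_preimage (A : set R) : measurable A ->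
  measurable (theta @^-1` A).
Proof. by move=> mA; rewrite -[X in measurable X]setTI; exact: mtheta. Qed.

Let k_ge0 : 0 <= k^-1. Proof. by rewrite invr_ge0 ltW. Qed.

Lemma lebesgue_measure_affine (A : set R) : measurable A ->
  mu (theta @^-1` A) = (k^-1%:E * mu A)%E.
Proof.
move=> mA.
have [m mE] : exists m : {measure set (measurableTypeR R) -> \bar R},
    forall B, m B = (k%:E * mu (theta @^-1` B))%E.
  have mt := mtheta.
  unshelve refine (ex_intro _ (mscale (NngNum (ltW k0)) (pushforward mu
    (theta : measurableTypeR R -> measurableTypeR R)) :
    {measure set (measurableTypeR R) -> \bar R}) _).
    exact: mt.
  by [].
have : mu A = m A.
  apply: lebesgue_measure_unique => //= _ [[a b]] _ <-.
  rewrite mE /=.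
  have -> : theta @^-1` `]a, b]%classic = `](a - c) / k, (b - c) / k]%classic.
    apply/seteqP; split => s /=; rewrite !in_itv /= /theta;
    by rewrite ltr_pdivrMr// ler_pdivlMr// ltrBlDr lerBrDr mulrC.
  rewrite !lebesgue_measure_itv /= !lte_fin ltr_pM2r ?invr_gt0// ltrD2r.
  case: ifP => _; last by rewrite mule0.
  by rewrite -!EFinB -EFinM; congr EFin; field; rewrite gt_eqF.
by rewrite mE => ->; rewrite muleA -EFinM mulVf ?mul1e// gt_eqF.
Qed.

Lemma ge0_integral_affine (D : set R) (f : R -> \bar R) : measurable D ->
  measurable_fun D f -> (forall x, D x -> (0 <= f x)%E) ->
  (\int[mu]_(s in theta @^-1` D) f (theta s) = k^-1%:E * \int[mu]_(s in D) f s)%E.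
Proof.
move=> mD mf f0.
have <- := @ge0_integral_pushforward _ _ _ _ _ _ mtheta mu D f mD mf; last first.
  by move=> x /set_mem; exact: f0.
rewrite -(ge0_integral_mscale mu mD (NngNum k_ge0) mf f0).
by apply: eq_measure_integral => //= A mA AD; exact: lebesgue_measure_affine.
Qed.

Lemma measurable_fun_affine (D : set R) (f : R -> R) : measurable D ->
  measurable_fun D f -> measurable_fun (theta @^-1` D) (f \o theta).
Proof.
move=> mD mf; apply: (measurable_comp mD) => //; last exact: measurable_funTS.
by move=> _ [s Ds <-].
Qed.

Lemma integrable_affine (D : set R) (f : R -> R) : measurable D ->
  mu.-integrable D (EFin \o f) ->
  mu.-integrable (theta @^-1` D) (EFin \o (f \o theta)).
Proof.
move=> mD /integrableP[/measurable_EFinP mf fi]; apply/integrableP; split.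
  by apply/measurable_EFinP; exact: measurable_fun_affine.
rewrite (@ge0_integral_affine D (fun s => `|(f s)%:E|%E))//.
  by rewrite lte_mul_pinfty.
by apply: measurableT_comp => //; exact/measurable_EFinP.
Qed.

Lemma Rintegral_affine (D : set R) (f : R -> R) : measurable D ->
  mu.-integrable D (EFin \o f) ->
  (\int[mu]_(s in theta @^-1` D) f (theta s) = k^-1 * \int[mu]_(s in D) f s)%R.
Proof.
move=> mD fi; rewrite /Rintegral.
rewrite integralE [in RHS]integralE.
have mf : measurable_fun D (EFin \o f) by case/integrableP: fi.
have -> : (\int[mu]_(s in theta @^-1` D) (fun s => (f (theta s))%:E)^\+ s =
    k^-1%:E * \int[mu]_(s in D) (EFin \o f)^\+ s)%E.
  rewrite -ge0_integral_affine//; last exact: measurable_funepos.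
  by apply: eq_integral => s _; rewrite !funeposE.
have -> : (\int[mu]_(s in theta @^-1` D) (fun s => (f (theta s))%:E)^\- s =
    k^-1%:E * \int[mu]_(s in D) (EFin \o f)^\- s)%E.
  rewrite -ge0_integral_affine//; last exact: measurable_funeneg.
  by apply: eq_integral => s _; rewrite !funenegE.
have p1 : (\int[mu]_(s in D) (EFin \o f)^\+ s)%E \is a fin_num.
  exact: integrable_pos_fin_num.
have p2 : (\int[mu]_(s in D) (EFin \o f)^\- s)%E \is a fin_num.
  exact: integrable_neg_fin_num.
by rewrite -muleBr ?fin_num_adde_defr// fineM// fin_numB p1 p2.
Qed.

End affine_change_of_variable.

(** * Growth of the Lagrangian *)

(** A real function whose second derivative lies between two nonnegative
    constants. *)
Lemma pinched_second_derivative (R : realType) (phi psi q : R -> R) (m M b : R) :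
  (forall l : R, is_derive l 1 phi (psi l)) ->
  (forall l : R, is_derive l 1 psi (q l)) ->
  0 <= m -> (forall l, m <= q l <= M) -> `|psi 0| <= b ->
  [/\ phi 0 - b + m / 4 <= phi 1, phi 1 <= phi 0 + b + M &
      forall k, 1 <= k <= 2 -> phi k <= phi 1 + (b + 2 * M) * (k - 1)].
Proof.
move=> dphi dpsi m0 qmM psib.
have cphi : continuous phi.
  by move=> l; apply/differentiable_continuous/derivable1_diffP; case: (dphi l).
have cpsi : continuous psi.
  by move=> l; apply/differentiable_continuous/derivable1_diffP; case: (dpsi l).
have mvt (u du : R -> R) x y : (forall l : R, is_derive l 1 u (du l)) ->
    continuous u -> x <= y -> exists2 z, x <= z <= y & u y - u x = du z * (y - x).
  move=> ud cu xy; have [|z zxy ->] := MVT_segment xy (fun z _ => ud z).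
    exact: continuous_subspaceT.
  by exists z => //; move: zxy; rewrite in_itv.
have psiE l : 0 <= l -> psi 0 + m * l <= psi l <= psi 0 + M * l.
  move=> l0; have [z _ E] := mvt _ _ _ _ dpsi cpsi l0.
  have /andP[q1 q2] := qmM z; rewrite subr0 in E.
  have := ler_wpM2r l0 q1; have := ler_wpM2r l0 q2; rewrite -E => h1 h2.
  by apply/andP; split; lra.
have M0 : 0 <= M by have /andP[h1 h2] := qmM 0; lra.
move: psib; rewrite ler_norml => /andP[b1 b2].
split.
- (* On [1 / 2, 1] the function [psi] is at least [psi 0 + m / 2]. *)
  have h1 : 0 <= 1 / 2 :> R by lra.
  have h2 : 1 / 2 <= 1 :> R by lra.
  have [x /andP[x0 _] Ex] := mvt _ _ _ _ dphi cphi h1.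
  have [y /andP[y0 _] Ey] := mvt _ _ _ _ dphi cphi h2.
  have /andP[px _] := psiE x x0.
  have /andP[py _] := psiE y (le_trans h1 y0).
  have mx : 0 <= m * x by rewrite mulr_ge0.
  have my : m * (1 / 2) <= m * y by rewrite ler_wpM2l.
  lra.
- have [x /andP[x0 x1] Ex] := mvt _ _ _ _ dphi cphi (@ler01 R).
  have /andP[_ px] := psiE x x0.
  have Mx : M * x <= M * 1 by rewrite ler_wpM2l.
  lra.
- move=> k /andP[k1 k2]; have [x /andP[x1 xk] Ex] := mvt _ _ _ _ dphi cphi k1.
  have x0 : 0 <= x by lra.
  have /andP[_ px] := psiE x x0.
  have Mx : M * x <= M * 2 by rewrite ler_wpM2l//; lra.
  have : psi x * (k - 1) <= (b + 2 * M) * (k - 1) by rewrite ler_wpM2r//; lra.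
  lra.
Qed.

Lemma is_derive_line (R : realType) (V W : normedModType R) (F : V -> W)
    (a v : V) (l : R) : differentiable F (a + l *: v) ->
  is_derive l 1 (fun l => F (a + l *: v)) ('D_v F (a + l *: v)).
Proof.
move=> dF; have := @diff_derivable _ _ _ _ _ v dF.
have E : (fun h : R => h^-1 *: (F (a + (h *: 1 + l) *: v) - F (a + l *: v))) =
         (fun h => h^-1 *: (F (h *: v + (a + l *: v)) - F (a + l *: v))).
  by apply/funext => h; rewrite [_%:A]mulr1 scalerDl addrCA.
by move=> dv; split; rewrite /derivable /derive E.
Qed.

Lemma is_derive_ray (R : realType) (V W : normedModType R) (F : V -> W) (v : V)
    (l : R) : differentiable F (l *: v) ->
  is_derive l 1 (fun l => F (l *: v)) ('D_v F (l *: v)).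
Proof.
move=> dF; have := @is_derive_line _ _ _ F 0 v l; rewrite add0r => /(_ dF).
by under eq_fun do rewrite add0r.
Qed.

Lemma derive_gradient (R : realType) (n : nat) (F : 'rV[R]_n -> R)
    (x v : 'rV[R]_n) : differentiable F x ->
  'D_v F x = dotr (gradient F x) v.
Proof.
move=> dF; rewrite deriveE// [in LHS](row_sum_delta v) linear_sum /=.
apply: eq_bigr => i _; rewrite linearZ /= mxE deriveE//.
by rewrite mulrC.
Qed.

Lemma is_derive_dotr (R : realType) (n : nat) (G : R -> 'rV[R]_n)
    (dG v : 'rV[R]_n) (l : R) : is_derive l 1 G dG ->
  is_derive l 1 (fun l => dotr (G l) v) (dotr dG v).
Proof.
move=> [dGl <-]; rewrite derive_mx//.
have -> : (fun l => dotr (G l) v) = \sum_(i < n) (fun l => v 0 i *: G l 0 i).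
  apply/funext => s; rewrite fct_sumE /dotr; apply: eq_bigr => i _.
  by rewrite mulrC.
rewrite /dotr; apply: is_derive_sum => i; rewrite mxE mulrC.
apply: (@is_deriveZ _ _ _ (fun l => G l 0 i)).
by apply: derivableP; move/derivable_mxP : dGl.
Qed.

(** Young's inequality absorbs the linear term into the quadratic one. *)
Lemma young_absorb (R : realType) (mu b e : R) : 0 < mu ->
  b * e <= e ^+ 2 / mu / 8 + 2 * (mu * b ^+ 2).
Proof.
move=> mu0.
have : 0 <= (e - 4 * mu * b) ^+ 2 / mu by rewrite divr_ge0 ?sqr_ge0 // ltW.
have -> : (e - 4 * mu * b) ^+ 2 / mu =
    e ^+ 2 / mu - 8 * (b * e) + 16 * (mu * b ^+ 2).
  by field; rewrite gt_eqF.
by move: (e ^+ 2 / mu) (b * e) (mu * b ^+ 2) => x y z; lra.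
Qed.

Lemma le_1Dsqr (R : realType) (b e : R) : 0 <= b -> b * e <= b * (1 + e ^+ 2).
Proof.
move=> b0; rewrite ler_wpM2l//.
by have := sqr_ge0 (e - 1); have := sqr_ge0 e; rewrite sqrrB; lra.
Qed.

Section lagrangian_bounds.
Context {R : realType} {n : nat}.
Variables (T : R) (U : set 'rV[R]_n) (f : R -> 'rV[R]_n -> 'rV[R]_n -> R).
Hypotheses (f0 : hyp_f0 T U f) (f1 : hyp_f1 T U f) (f2 : hyp_f2 T U f).

(** Along the ray through [v], the function [l |-> f t x (l *: v)] has second
    derivative between [dotr v v / mu] and [mu * dotr v v] and first derivative
    at 0 at most [n * M * enorm v] in absolute value. *)
Lemma lagrangian_ray_bounds : exists (c C : R), [/\ 0 < c, 0 <= C &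
  forall t x v, t \in `[0, T] -> U x ->
  [/\ c * dotr v v - C <= f t x v, f t x v <= C * (1 + dotr v v) &
      forall k, 1 <= k <= 2 ->
        f t x (k *: v) <= f t x v + C * (1 + dotr v v) * (k - 1)]].
Proof.
have [_ df _ _ [M M0 fM]] := f0.
have [dDv [mu mu1 fmu]] := f1.
have mu0 : 0 < mu by lra.
pose b := n%:R * M.
have b0 : 0 <= b by rewrite mulr_ge0.
exists (8 * mu)^-1, (2 * M + 2 * b + 2 * mu + 2 * (mu * b ^+ 2)); split.
- by rewrite invr_gt0; lra.
- by have := mulr_ge0 (ltW mu0) (sqr_ge0 b); lra.
move=> t x v tT Ux.
pose phi (l : R) := f t x (l *: v).
pose psi (l : R) := dotr (Dv f t x (l *: v)) v.
pose q (l : R) := dotr (v *m D2vv f t x (l *: v)) v.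
have dinj w : differentiable (fun w : 'rV[R]_n => (x, w)) w.
  by apply: differentiable_pair => //; exact: differentiable_cst.
have dphi (l : R) : is_derive l 1 phi (psi l).
  have dfx : differentiable (fun w => f t x w) (l *: v).
    exact: (differentiable_comp (dinj _) (df t x (l *: v) tT Ux)).
  rewrite /psi /Dv -derive_gradient//.
  exact: (@is_derive_ray _ _ _ (fun w => f t x w)).
have dpsi (l : R) : is_derive l 1 psi (q l).
  have dfx : differentiable (fun w => Dv f t x w) (l *: v).
    have [dD _] := dDv t tT.
    exact: (differentiable_comp (dinj _) (dD (x, l *: v) (conj Ux Logic.I))).
  have ray := @is_derive_ray _ _ _ (fun w => Dv f t x w) v l dfx.
  rewrite (deriveEjacobian v dfx) in ray.
  exact: (@is_derive_dotr _ _ (fun l => Dv f t x (l *: v)) _ v l ray).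
set E := dotr v v; have E0 : 0 <= E by exact: dotr_ge0.
have qb l : E / mu <= q l <= E * mu.
  by have [/(_ v)] := fmu t x (l *: v) tT Ux.
have Em0 : 0 <= E / mu by rewrite divr_ge0 // ltW.
have := fM t x tT Ux => fM0.
have hD : enorm (Dv f t x 0) <= M.
  by apply: le_trans fM0; rewrite lerDr addr_ge0 ?normr_ge0 ?enorm_ge0.
have hf : `|f t x 0| <= M.
  by apply: le_trans fM0; rewrite -addrA lerDl addr_ge0 ?enorm_ge0.
have psib : `|psi 0| <= b * enorm v.
  by rewrite /psi scale0r; exact: dotr_le.
have [lo up ray] := pinched_second_derivative dphi dpsi Em0 qb psib.
rewrite /phi scale0r scale1r in lo up ray.
have eE : enorm v ^+ 2 = E by exact: sqr_enorm.
have e0 := enorm_ge0 v.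
clearbody E; move: (enorm v) eE e0 psib lo up ray => e eE e0 psib lo up ray.
move: hf; rewrite ler_norml => /andP[hf1 hf2].
have young : b * e <= E / mu / 8 + 2 * (mu * b ^+ 2).
  by rewrite -eE; exact: young_absorb.
have young' : b * e <= b * (1 + E) by rewrite -eE; exact: le_1Dsqr.
have cE : (8 * mu)^-1 * E = E / mu / 8 by field; rewrite gt_eqF.
have mub : 0 <= mu * b ^+ 2 by rewrite mulr_ge0 ?sqr_ge0 // ltW.
have bE : 0 <= b * E by rewrite mulr_ge0.
have ME : 0 <= M * E by rewrite mulr_ge0.
have muE : 0 <= mu * E by rewrite mulr_ge0 // ltW.
have mubE : 0 <= mu * b ^+ 2 * E by rewrite mulr_ge0.
rewrite mulrC in muE; rewrite cE.
have CE : (2 * M + 2 * b + 2 * mu + 2 * (mu * b ^+ 2)) * (1 + E) =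
  2 * M + 2 * b + 2 * mu + 2 * (mu * b ^+ 2) +
  (2 * (M * E) + 2 * (b * E) + 2 * (E * mu) + 2 * (mu * b ^+ 2 * E)) by ring.
have up' : M + (b * e + 2 * (E * mu)) <=
    (2 * M + 2 * b + 2 * mu + 2 * (mu * b ^+ 2)) * (1 + E).
  rewrite CE; move: young'; rewrite mulrDr mulr1.
  clear -mub bE ME muE mubE b0 M0 mu0.
  move: (b * e) (b * E) (M * E) (E * mu) (mu * b ^+ 2 * E) (mu * b ^+ 2) bE ME muE mubE mub.
  by move=> x0 x1 x2 x3 x4 x5; lra.
have lo' : E / mu / 8 - (2 * M + 2 * b + 2 * mu + 2 * (mu * b ^+ 2)) <=
    f t x 0 - b * e + E / mu / 4.
  clear -young hf1 b0 mu0 Em0 M0.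
  by move: (E / mu) (b * e) (mu * b ^+ 2) (f t x 0) Em0 young hf1 => x1 x2 x3 x4; lra.
split.
- exact: le_trans lo' lo.
- apply: (le_trans up); apply: le_trans up'.
  clear -muE hf2; move: (E * mu) (b * e) (f t x 0) muE hf2 => x1 x2 x3; lra.
- move=> k k12; apply: (le_trans (ray k k12)).
  rewrite lerD2l ler_wpM2r//; first by case/andP: k12; rewrite subr_ge0.
  by clear -up' M0; move: (E * mu) up' => x1 up'; lra.
Qed.

(** All that is used of the Lagrangian: quadratic growth, and bounds on the loss
    incurred when the velocity is multiplied by [k] or the time is moved. *)
Lemma lagrangian_bounds : exists (c C : R), [/\ 0 < c, 0 <= C &
  forall t x v, t \in `[0, T] -> U x ->
  [/\ c * dotr v v - C <= f t x v, f t x v <= C * (1 + dotr v v),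
      forall k, 1 <= k <= 2 ->
        f t x (k *: v) <= f t x v + C * (1 + dotr v v) * (k - 1) &
      forall s, s \in `[0, T] ->
        f t x v <= f s x v + C * (1 + dotr v v) * `|t - s|]].
Proof.
have [c [C [c0 C0 H]]] := lagrangian_ray_bounds.
have [_ [kappa k0 fk]] := f2.
exists c, (C + kappa); split => //; first exact: addr_ge0.
move=> t x v tT Ux; have [h1 h2 h3] := H t x v tT Ux.
have E0 := dotr_ge0 v; set E := dotr v v in h1 h2 h3 E0 *.
have kE : 0 <= kappa * (1 + E) by rewrite mulr_ge0//; lra.
have CE : 0 <= C * (1 + E) by rewrite mulr_ge0//; lra.
split.
- lra.
- by rewrite mulrDl; lra.
- move=> k k12; apply: le_trans (h3 k k12) _; rewrite lerD2l ler_wpM2r//.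
    by case/andP: k12; lra.
  by rewrite mulrDl; lra.
- move=> s sT; have [h _] := fk t s x v tT sT Ux.
  rewrite sqr_enorm -/E ler_norml in h.
  have : 0 <= C * (1 + E) * `|t - s| by rewrite mulr_ge0.
  by case/andP: h => _; rewrite mulrDl mulrDl; lra.
Qed.

End lagrangian_bounds.

(** * Local Lipschitz bounds and compactness *)

(** A property of pairs of points of a compact set that holds near each point,
    with a constant depending on the point, holds with one constant for all
    pairs of close points. *)
Lemma compact_uniform (R : realType) (n : nat) (K : set 'rV[R]_n)
    (P : R -> 'rV[R]_n -> 'rV[R]_n -> Prop) : compact K ->
  (forall C C' x y, C <= C' -> P C x y -> P C' x y) ->
  (forall x0, K x0 -> exists (r C : R), 0 < r /\ forall x y, K x -> K y ->
     `|x - x0| < r -> `|y - x0| < r -> P C x y) ->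
  exists (r C : R), 0 < r /\ forall x y, K x -> K y -> `|x - y| < r -> P C x y.
Proof.
move=> cK Pmono Ploc.
have /compact_near_coveringP := cK.
move=> /(_ R +oo (fun C x => K x -> forall y, K y -> `|x - y| < C^-1 -> P C x y)).
move=> /(_ _ _)[|C [Creal HC]].
  move=> x0 Kx0; have [r [C [r0 H]]] := Ploc x0 Kx0.
  exists (ball x0 (r / 2), [set C' | C <= C' /\ 2 / r < C']) => /=.
    split; first by apply: nbhsx_ballx; lra.
    by apply: filterI; [apply: nbhs_pinfty_ge|apply: nbhs_pinfty_gt]; exact: num_real.
  move=> [x C'] /= [xr [CC rC]] Kx y Ky xy; apply: (Pmono C) => //.
  move: xr; rewrite -ball_normE /= => xr.
  have xr2 : `|x - x0| < r / 2 by rewrite distrC.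
  have xr' : `|x - x0| < r by lra.
  apply: H => //.
  have C'0 : 0 < C' by apply: lt_trans rC; rewrite divr_gt0.
  have : C'^-1 < r / 2 by rewrite invf_plt ?posrE ?divr_gt0// invf_div.
  have : `|y - x0| <= `|x - y| + `|x - x0|.
    by rewrite (distrC x y); exact: ler_distD.
  by lra.
pose D := Num.max 0 C + 1.
have CD : C < D.
  have : C <= Num.max 0 C by rewrite le_max lexx orbT.
  by rewrite /D; lra.
have D0 : 0 < D.
  have : 0 <= Num.max 0 C by rewrite le_max lexx.
  by rewrite /D; lra.
exists D^-1, D; split; first by rewrite invr_gt0.
by move=> x y Kx Ky xy; exact: (HC D CD x Kx).
Qed.

Lemma mean_value (R : realType) (u du : R -> R) :
  (forall l : R, l \in `[0, 1] -> is_derive l 1 u (du l)) ->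
  exists2 c, c \in `[0, 1] & u 1 - u 0 = du c.
Proof.
move=> udu.
have cu : {within `[0, 1], continuous u}.
  by apply: derivable_within_continuous => l l01; case: (udu l l01).
have udu' (l : R) : l \in `]0, 1[ -> is_derive l 1 u (du l).
  by move=> l01; apply: udu; exact: subset_itv_oo_cc.
have [c c01 E] := MVT_segment ler01 udu' cu.
by exists c => //; rewrite E subr0 mulr1.
Qed.

Lemma lipschitz_on_ball (R : realType) (m : nat) (F : 'rV[R]_m -> R)
    (z : 'rV[R]_m) (r B : R) :
  (forall x, `|x - z| < r -> differentiable F x /\
     forall j, `|'D_(delta_mx 0 j) F x| <= B) ->
  forall x y, `|x - z| < r -> `|y - z| < r -> `|F x - F y| <= m%:R * B * `|x - y|.
Proof.
move=> HF x y xr yr.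
have seg l : 0 <= l <= 1 -> `|y + l *: (x - y) - z| < r.
  move=> /andP[l0 l1].
  have -> : y + l *: (x - y) - z = (1 - l) *: (y - z) + l *: (x - z).
    by apply/matrixP => i j; rewrite !mxE; ring.
  apply: le_lt_trans (ler_normD _ _) _.
  rewrite !normrZ !ger0_norm ?subr_ge0//.
  have : (1 - l) * `|y - z| <= (1 - l) * Num.max `|x - z| `|y - z|.
    by rewrite ler_wpM2l ?subr_ge0// le_max lexx orbT.
  have : l * `|x - z| <= l * Num.max `|x - z| `|y - z|.
    by rewrite ler_wpM2l// le_max lexx.
  have : Num.max `|x - z| `|y - z| < r by rewrite gt_max xr yr.
  by lra.
pose u l := F (y + l *: (x - y)).
have du (l : R) : l \in `[0, 1] -> is_derive l 1 u ('D_(x - y) F (y + l *: (x - y))).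
  by rewrite in_itv /= => /seg /HF[dF _]; exact: is_derive_line.
have [c c01] := mean_value du.
rewrite /u scale1r scale0r addr0 (addrC y) subrK => ->.
move: c01; rewrite in_itv /= => /seg /HF[dF DF].
rewrite derive_gradient// /dotr.
apply: le_trans (ler_norm_sum _ _ _) _.
apply: (@le_trans _ _ (\sum_(i < m) B * `|x - y|)); last first.
  by rewrite sumr_const card_ord -mulrA [leRHS]mulr_natl.
apply: ler_sum => i _; rewrite normrM ler_pM//; last exact: coord_le_norm.
by rewrite mxE; exact: DF.
Qed.

Lemma C1_locally_lipschitz (R : realType) (m : nat) (F : 'rV[R]_m -> R)
    (z : 'rV[R]_m) : C1_on setT F ->
  exists (r B : R), [/\ 0 < r, 0 <= B & forall x y,
    `|x - z| < r -> `|y - z| < r -> `|F x - F y| <= B * `|x - y|].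
Proof.
move=> [dF cF].
pose B := \sum_(j < m) (`|'D_(delta_mx 0 j) F z| + 1).
have : \forall x \near z, forall j : 'I_m, `|'D_(delta_mx 0 j) F x| <= B.
  apply: (@filter_forall _ 'I_m (fun j x => `|'D_(delta_mx 0 j) F x| <= B) (nbhs z) _) => j.
  have cj : (fun x => 'D_(delta_mx 0 j) F x) @ z --> 'D_(delta_mx 0 j) F z.
    exact: ((continuous_subspace_setT _).2 (cF (delta_mx 0 j)) z).
  move/cvgrPdist_le : cj => /(_ 1 ltr01); apply: filterS => x.
  set a := 'D_ _ F x; set b := 'D_ _ F z => ab.
  apply: (@le_trans _ _ (`|b| + 1)).
    by rewrite addrC -lerBlDr (le_trans (lerB_dist _ _))// distrC.
  rewrite /B (bigD1 j)//= -/b lerDl; apply: sumr_ge0 => k _.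
  by rewrite addr_ge0.
move=> /nbhs_ballP[r /= r0 rB].
have B0 : 0 <= B by apply: sumr_ge0 => k _; rewrite addr_ge0.
exists r, (m%:R * B); split => //; first by rewrite mulr_ge0.
apply: lipschitz_on_ball => x xz; split; first exact: dF.
by apply: rB; rewrite -ball_normE /= distrC.
Qed.

(** * Joining points inside the closure of a smooth domain *)

(** [joinable K L x y]: some curve joins [y] to [x] inside [K], and it is
    Lipschitz continuous on [0, 1] with constant [L * `|x - y|]. *)
Definition joinable (R : realType) (n : nat) (K : set 'rV[R]_n) (L : R)
    (x y : 'rV[R]_n) : Prop :=
  exists p : R -> 'rV[R]_n, [/\ p 0 = y, p 1 = x,
    forall l, 0 <= l <= 1 -> K (p l) &
    forall l k, 0 <= l <= 1 -> 0 <= k <= 1 ->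
      `|p l - p k| <= L * `|x - y| * `|l - k|].

Lemma joinable_le (R : realType) (n : nat) (K : set 'rV[R]_n) (L L' : R)
    (x y : 'rV[R]_n) : L <= L' -> joinable K L x y -> joinable K L' x y.
Proof.
move=> LL' [p [p0 p1 pK plip]]; exists p; split => // l k l01 k01.
by apply: le_trans (plip l k l01 k01) _; rewrite !ler_wpM2r.
Qed.

(** The parabolic arc from [y] to [x] that bulges in the direction [e]. *)
Definition arc (R : realType) (n : nat) (x y e : 'rV[R]_n) (b l : R) : 'rV[R]_n :=
  y + l *: (x - y) + (b * (l * (1 - l))) *: e.

Section arc_theory.
Context {R : realType} {n : nat}.
Implicit Types (x y e : 'rV[R]_n) (b l k : R).

Lemma arc0 x y e b : arc x y e b 0 = y.
Proof. by rewrite /arc scale0r mul0r mulr0 scale0r !addr0. Qed.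

Lemma arc1 x y e b : arc x y e b 1 = x.
Proof. by rewrite /arc scale1r subrr !mulr0 scale0r addr0 addrC subrK. Qed.

Lemma arc_near x y e b l z r : 0 <= b -> 0 <= l <= 1 -> `|x - z| < r ->
  `|y - z| < r -> `|arc x y e b l - z| < r + b * `|e|.
Proof.
move=> b0 /andP[l0 l1] xz yz.
have -> : arc x y e b l - z =
    ((1 - l) *: (y - z) + l *: (x - z)) + (b * (l * (1 - l))) *: e.
  by apply/matrixP => i j; rewrite !mxE; ring.
apply: le_lt_trans (ler_normD _ _) _; apply: ltr_leD.
  apply: le_lt_trans (ler_normD _ _) _.
  rewrite !normrZ !ger0_norm ?subr_ge0//.
  have : (1 - l) * `|y - z| <= (1 - l) * Num.max `|x - z| `|y - z|.
    by rewrite ler_wpM2l ?subr_ge0// le_max lexx orbT.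
  have : l * `|x - z| <= l * Num.max `|x - z| `|y - z|.
    by rewrite ler_wpM2l// le_max lexx.
  have : Num.max `|x - z| `|y - z| < r by rewrite gt_max xz yz.
  by lra.
rewrite normrZ ler_wpM2r// ger0_norm; last first.
  by rewrite mulr_ge0// mulr_ge0// subr_ge0.
by rewrite ler_piMr// mulr_ile1// ?subr_ge0//; lra.
Qed.

Lemma arc_lipschitz x y e b l k : 0 <= b -> 0 <= l <= 1 -> 0 <= k <= 1 ->
  `|arc x y e b l - arc x y e b k| <= (`|x - y| + b * `|e|) * `|l - k|.
Proof.
move=> b0 /andP[l0 l1] /andP[k0 k1].
have -> : arc x y e b l - arc x y e b k =
    (l - k) *: (x - y) + (b * ((l - k) * (1 - l - k))) *: e.
  by apply/matrixP => i j; rewrite !mxE; ring.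
apply: le_trans (ler_normD _ _) _.
rewrite !normrZ (ger0_norm b0) mulrDl (mulrC `|x - y|) lerD2l.
rewrite -!mulrA ler_wpM2l// (mulrC `|e|) ler_wpM2l// ler_piMl//.
by rewrite ler_norml; apply/andP; split; lra.
Qed.

End arc_theory.

(** The sum of the absolute values of the entries, a bound for the matrix as a
    linear map for the maximum norms. *)
Definition mx_bound (R : realType) (n m : nat) (A : 'M[R]_(n, m)) : R :=
  \sum_(k < n) \sum_(j < m) `|A k j|.

Lemma mx_bound_ge0 (R : realType) (n m : nat) (A : 'M[R]_(n, m)) : 0 <= mx_bound A.
Proof. by apply: sumr_ge0 => k _; apply: sumr_ge0. Qed.

Lemma mulmx_coord_bound (R : realType) (n m : nat) (A : 'M[R]_(n, m))
    (z : 'rV[R]_n) (j : 'I_m) : `|(z *m A) 0 j| <= mx_bound A * `|z|.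
Proof.
rewrite mxE; apply: le_trans (ler_norm_sum _ _ _) _.
rewrite /mx_bound mulr_suml; apply: ler_sum => k _.
rewrite normrM mulrC ler_pM//; last exact: coord_le_norm.
by rewrite (bigD1 j)//= lerDl; apply: sumr_ge0.
Qed.

(** Near [x0], in the coordinates [pr] and [ht], the domain is the strict
    epigraph of a function [phi] that is Lipschitz continuous with constant [B];
    [e] is the direction along which [ht] grows and [pr] is constant. *)
Section epigraph_chart.
Context {R : realType} {n : nat}.
Variables (Omega : set 'rV[R]_n) (x0 : 'rV[R]_n) (r B : R) (Q : 'M[R]_n)
  (i : 'I_n) (phi : 'rV[R]_n.-1 -> R).
Let pr (z : 'rV[R]_n) := col' i (z *m Q).
Let ht (z : 'rV[R]_n) := (z *m Q) 0 i.
Hypotheses (r0 : 0 < r) (B0 : 0 <= B) (QT : Q *m Q^T = 1%:M).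
Hypothesis chart : forall y, `|y - x0| < r -> (Omega y <-> phi (pr y) < ht y).
Hypothesis phi_lip : forall x y, `|x - x0| < r -> `|y - x0| < r ->
  `|phi (pr x) - phi (pr y)| <= B * `|pr x - pr y|.

Let e : 'rV[R]_n := delta_mx 0 i *m Q^T.

Let eQ : e *m Q = delta_mx 0 i.
Proof. by rewrite /e -mulmxA (mulmx1C QT) mulmx1. Qed.

Let pr_line x y l b : pr (y + l *: x + b *: e) = pr y + l *: pr x.
Proof.
rewrite /pr !mulmxDl -!scalemxAl eQ; apply/rowP => j; rewrite !mxE.
by rewrite eq_sym eqxx (negbTE (neq_lift _ _)) mulr0 addr0.
Qed.

Let ht_line x y l b : ht (y + l *: x + b *: e) = ht y + l * ht x + b.
Proof. by rewrite /ht !mulmxDl -!scalemxAl eQ !mxE !eqxx mulr1. Qed.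

Let prB x y : `|pr x - pr y| <= mx_bound Q * `|x - y|.
Proof.
apply: norm_le_coord; first by rewrite mulr_ge0// mx_bound_ge0.
by move=> j; have := mulmx_coord_bound Q (x - y) (lift i j); rewrite mulmxBl !mxE.
Qed.

Let htB x y : `|ht x - ht y| <= mx_bound Q * `|x - y|.
Proof.
have -> : ht x - ht y = ((x - y) *m Q) 0 i by rewrite mulmxBl [RHS]mxE [X in _ = _ + X]mxE.
exact: mulmx_coord_bound.
Qed.

Let closure_le z : `|z - x0| < r -> closure Omega z -> phi (pr z) <= ht z.
Proof.
move=> zr clz; rewrite leNgt; apply/negP => zphi.
pose q := mx_bound Q; have q0 : 0 <= q := mx_bound_ge0 Q.
have Bq : 0 <= B * q by rewrite mulr_ge0.
have D0 : 0 < B * q + q + 1 by rewrite ltr_wpDl// addr_ge0.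
pose d := (phi (pr z) - ht z) / (B * q + q + 1).
have d0 : 0 < d by rewrite divr_gt0// subr_gt0.
pose s := Num.min d (r - `|z - x0|).
have s0 : 0 < s by rewrite lt_min d0 subr_gt0.
have [y [Oy]] := clz _ (nbhsx_ballx z s s0).
rewrite -ball_normE /= lt_min => /andP[zyd zyr].
have yr : `|y - x0| < r.
  apply: le_lt_trans (ler_distD z _ _) _; rewrite (distrC y z); lra.
have /chart - /(_ yr) := Oy.
have h1 := phi_lip zr yr; have h2 := htB z y; have h3 := prB z y.
have h4 : B * `|pr z - pr y| <= B * (q * `|z - y|) by rewrite ler_wpM2l.
have h5 : (B * q + q + 1) * `|z - y| < phi (pr z) - ht z.
  by rewrite mulrC -ltr_pdivlMr.
move: h1 h2; rewrite !ler_norml -/q => /andP[_ h1] /andP[h2 _] h7.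
have h8 : (B * q + q + 1) * `|z - y| = B * (q * `|z - y|) + q * `|z - y| + `|z - y|.
  by ring.
rewrite h8 in h5.
have contra (a b c d' X Y N : R) : a - b <= X -> - Y <= c - d' -> b < d' ->
  0 <= N -> X + Y + N < a - c -> False by lra.
exact: (contra _ _ _ _ _ _ _ (le_trans h1 h4) h2 h7 (normr_ge0 (z - y)) h5).
Qed.

Let le_closure z : `|z - x0| < r -> phi (pr z) <= ht z -> closure Omega z.
Proof.
move=> zr phz A /nbhs_ballP[s /= s0 sA].
have e0 : 0 < `|e| + 1 by rewrite ltr_wpDl.
pose d := Num.min s (r - `|z - x0|) / 2 / (`|e| + 1).
have m0 : 0 < Num.min s (r - `|z - x0|) by rewrite lt_min s0 subr_gt0.
have d0 : 0 < d by rewrite !divr_gt0.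
have de : `|d *: e| < Num.min s (r - `|z - x0|).
  rewrite normrZ gtr0_norm//; apply: (@le_lt_trans _ _ (d * (`|e| + 1))).
    by rewrite ler_pM2l// lerDl.
  by rewrite /d divfK ?gt_eqF//; lra.
exists (z + d *: e); split; last first.
  apply: sA; rewrite -ball_normE /= opprD addNKr normrN.
  by apply: lt_le_trans de _; rewrite ge_min lexx.
have zr' : `|z + d *: e - x0| < r.
  rewrite addrAC; apply: le_lt_trans (ler_normD _ _) _.
  have : Num.min s (r - `|z - x0|) <= r - `|z - x0| by rewrite ge_min lexx orbT.
  by lra.
have E : z + d *: e = z + 0 *: 0 + d *: e by rewrite scaler0 addr0.
apply/chart => //; rewrite E pr_line ht_line !scale0r !mul0r !addr0.
by apply: le_lt_trans phz _; rewrite ltrDl.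
Qed.

(** At the parameter [l], the arc from [y] to [x] has
    [phi (pr _) <= ht y + B * q * l * `|x - y|] and
    [phi (pr _) <= ht x + B * q * (1 - l) * `|x - y|]; averaging these with the
    weights [1 - l] and [l] shows that raising the segment by
    [2 * B * q * l * (1 - l) * `|x - y|] along [e] keeps it in the closed
    epigraph. *)
Lemma chart_joinable : exists (s L : R), 0 < s /\ forall x y,
  closure Omega x -> closure Omega y -> `|x - x0| < s -> `|y - x0| < s ->
  joinable (closure Omega) L x y.
Proof.
pose q := mx_bound Q; have q0 : 0 <= q := mx_bound_ge0 Q.
have Bq : 0 <= B * q by rewrite mulr_ge0.
have Bqe : 0 <= B * q * `|e| by rewrite mulr_ge0.
pose s := r / (1 + 4 * (B * q * `|e|)).
have D0 : 0 < 1 + 4 * (B * q * `|e|) by lra.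
have s0 : 0 < s by rewrite divr_gt0.
have sr : s + 4 * (B * q * `|e|) * s = r.
  by rewrite -[X in X + _]mul1r -mulrDl mulrC divfK// gt_eqF.
exists s, (1 + 2 * (B * q) * `|e|); split => // x y Kx Ky xs ys.
have xy2 : `|x - y| <= 2 * s.
  by have := ler_distD x0 x y; rewrite (distrC x0 y); lra.
pose b := 2 * (B * q) * `|x - y|.
have b0 : 0 <= b by rewrite !mulr_ge0.
have s4 : 0 <= 4 * (B * q * `|e|) * s by apply: mulr_ge0 (ltW s0); rewrite mulr_ge0.
have inr l : 0 <= l <= 1 -> `|arc x y e b l - x0| < r.
  move=> l01; apply: lt_le_trans (arc_near e b0 l01 xs ys) _.
  rewrite -sr lerD2l /b.
  have : (B * q * `|e|) * `|x - y| <= (B * q * `|e|) * (2 * s) by rewrite ler_wpM2l.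
  by rewrite -!mulrA (mulrC `|x - y|); lra.
have srr : s <= r by rewrite -sr lerDl.
exists (arc x y e b); split; [exact: arc0|exact: arc1| |]; last first.
  move=> l k l01 k01; apply: le_trans (arc_lipschitz x y e b0 l01 k01) _.
  rewrite ler_wpM2r// /b; by rewrite le_eqVlt; apply/orP; left; apply/eqP; ring.
move=> l /[dup] l01 /andP[l0 l1]; apply: le_closure; first exact: inr.
have xr : `|x - x0| < r by apply: lt_le_trans srr.
have yr : `|y - x0| < r by apply: lt_le_trans srr.
have phx := closure_le xr Kx; have phy := closure_le yr Ky.
have prE : pr (arc x y e b l) = pr y + l *: (pr x - pr y).
  by rewrite pr_line; congr (_ + _ *: _); rewrite /pr mulmxBl; apply/rowP => j; rewrite !mxE.
have htE : ht (arc x y e b l) = ht y + l * (ht x - ht y) + b * (l * (1 - l)).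
  by rewrite ht_line; congr (_ + _ * _ + _); rewrite /ht mulmxBl mxE [X in _ + X]mxE.
have N0 := normr_ge0 (x - y); have prxy := prB x y.
have py : phi (pr (arc x y e b l)) <= ht y + B * q * `|x - y| * l.
  have := phi_lip (inr l l01) yr; rewrite ler_norml => /andP[_ h].
  rewrite prE in h *; rewrite addrAC subrr add0r normrZ (ger0_norm l0) in h.
  have h2 : B * (l * `|pr x - pr y|) <= B * q * `|x - y| * l.
    by rewrite -!mulrA ler_wpM2l// mulrC mulrA ler_wpM2r.
  by have := le_trans h h2; move: phy; lra.
have px : phi (pr (arc x y e b l)) <= ht x + B * q * `|x - y| * (1 - l).
  have := phi_lip (inr l l01) xr; rewrite ler_norml => /andP[_ h].
  rewrite prE in h *.
  have E : pr y + l *: (pr x - pr y) - pr x = (l - 1) *: (pr x - pr y).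
    by apply/rowP => j; rewrite !mxE; ring.
  have l1' : `|l - 1| = 1 - l by rewrite ler0_norm ?opprB// subr_le0.
  rewrite E normrZ l1' in h.
  have h2 : B * ((1 - l) * `|pr x - pr y|) <= B * q * `|x - y| * (1 - l).
    by rewrite -!mulrA ler_wpM2l// mulrC mulrA ler_wpM2r// subr_ge0.
  by have := le_trans h h2; move: phx; lra.
rewrite htE /b.
have h1 : (1 - l) * phi (pr (arc x y e b l)) <=
    (1 - l) * (ht y + B * q * `|x - y| * l) by rewrite ler_wpM2l// subr_ge0.
have h2 : l * phi (pr (arc x y e b l)) <=
    l * (ht x + B * q * `|x - y| * (1 - l)) by rewrite ler_wpM2l.
apply: le_trans (_ : _ <= (1 - l) * (ht y + B * q * `|x - y| * l) +
  l * (ht x + B * q * `|x - y| * (1 - l))) _; last first.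
  by rewrite le_eqVlt; apply/orP; left; apply/eqP; ring.
apply: le_trans (lerD h1 h2); rewrite -mulrDl.
by rewrite subrK mul1r.
Qed.

End epigraph_chart.

(** Segments suffice near an interior point. *)
Lemma closure_locally_joinable (R : realType) (n : nat) (Omega : set 'rV[R]_n) :
  open Omega -> C2_boundary Omega -> forall x0, closure Omega x0 ->
  exists (r L : R), 0 < r /\ forall x y, closure Omega x -> closure Omega y ->
    `|x - x0| < r -> `|y - x0| < r -> joinable (closure Omega) L x y.
Proof.
move=> oO bO x0 clx0; have [Ox0|Ox0] := pselect (Omega x0).
  have [r /= r0 rO] : nbhs_ball x0 Omega by apply/nbhs_ballP; exact: open_nbhs_nbhs.
  exists r, 1; split => // x y _ _ xr yr.
  exists (arc x y 0 0); split; [exact: arc0|exact: arc1| |].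
    move=> l l01; apply/subset_closure/rO; rewrite -ball_normE /= distrC.
    have := arc_near 0 (lexx 0) l01 xr yr.
    by rewrite mul0r addr0.
  move=> l k l01 k01; have := arc_lipschitz x y 0 (lexx 0) l01 k01.
  by rewrite mul0r addr0 mul1r.
have [|r [Q [i [phi [r0 QT [Cphi _] chart]]]]] := bO x0.
  by split => // /interior_subset.
have [r1 [B [r10 B0 phiB]]] := C1_locally_lipschitz (col' i (x0 *m Q)) Cphi.
pose q := mx_bound Q; have q0 : 0 <= q := mx_bound_ge0 Q.
have q1 : 0 < q + 1 by rewrite ltr_wpDl.
have n1 : 0 < n%:R + 1 :> R by rewrite ltr_wpDl.
pose s := Num.min (r / (n%:R + 1)) (r1 / (q + 1)).
have s0 : 0 < s by rewrite lt_min !divr_gt0.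
apply: (@chart_joinable _ _ Omega x0 s B Q i phi) => //.
  move=> y ys; apply: chart; apply: le_lt_trans (enorm_le_norm _) _.
  have : `|y - x0| * (n%:R + 1) < r.
    by rewrite -ltr_pdivlMr//; apply: lt_le_trans ys _; rewrite ge_min lexx.
  apply: le_lt_trans; rewrite mulrC ler_wpM2l//; lra.
have prs y : `|y - x0| < s -> `|col' i (y *m Q) - col' i (x0 *m Q)| < r1.
  move=> ys; apply: (@le_lt_trans _ _ (q * `|y - x0|)).
    apply: norm_le_coord; first by rewrite mulr_ge0.
    by move=> j; have := mulmx_coord_bound Q (y - x0) (lift i j); rewrite mulmxBl !mxE.
  have : `|y - x0| * (q + 1) < r1.
    by rewrite -ltr_pdivlMr//; apply: lt_le_trans ys _; rewrite ge_min lexx orbT.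
  apply: le_lt_trans; rewrite mulrC ler_wpM2l//; lra.
by move=> x y xs ys; apply: phiB; exact: prs.
Qed.

Lemma compact_closure_bounded (R : realType) (n : nat) (A : set 'rV[R]_n) :
  bounded_set A -> compact (closure A).
Proof.
move=> [M [Mreal AM]]; apply: bounded_closed_compact; last exact: closed_closure.
exists (M + 1); split; first by rewrite realE; case: (leP 0 (M + 1)) => // /ltW.
move=> C CM x clx; rewrite /= leNgt; apply/negP => Cx.
have [|y [Ay]] := clx (ball x (`|x| - C)); first by apply: nbhsx_ballx; rewrite subr_gt0.
rewrite -ball_normE /= => xy; have yC : `|y| <= C by apply: AM => //; lra.
by have := lerB_dist x y; lra.
Qed.

Lemma closure_joinable (R : realType) (n : nat) (Omega : set 'rV[R]_n) :
  open Omega -> bounded_set Omega -> C2_boundary Omega ->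
  exists (r L : R), 0 < r /\ forall x y, closure Omega x -> closure Omega y ->
    `|x - y| < r -> joinable (closure Omega) L x y.
Proof.
move=> oO bO CO; apply: compact_uniform.
- exact: compact_closure_bounded.
- by move=> C C' x y CC; exact: joinable_le.
- exact: closure_locally_joinable.
Qed.

Lemma final_cost_lipschitz (R : realType) (n : nat) (Omega U : set 'rV[R]_n)
    (g : 'rV[R]_n -> R) : bounded_set Omega -> open U -> closure Omega `<=` U ->
  hyp_g1 U g -> exists K L : R, [/\ 0 <= L,
    forall x, closure Omega x -> `|g x| <= K &
    forall x y, closure Omega x -> closure Omega y ->
      `|g x - g y| <= L * `|x - y|].
Proof.
move=> bO oU OU [[dg _] [K gK]].
have [r [C [r0 HC]]] : exists (r C : R), 0 < r /\ forall x y, closure Omega x ->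
    closure Omega y -> `|x - y| < r -> `|g x - g y| <= C * `|x - y|.
  apply: compact_uniform; first exact: compact_closure_bounded.
    by move=> C C' x y CC; move/le_trans; apply; rewrite ler_wpM2r.
  move=> x0 Kx0; have /nbhs_ballP[r /= r0 rU] := open_nbhs_nbhs (conj oU (OU _ Kx0)).
  exists r, (n%:R * K); split => // x y _ _; apply: lipschitz_on_ball => z zr.
  have Uz : U z by apply: rU; rewrite -ball_normE /= distrC.
  split => [|j]; first exact: dg.
  apply: le_trans (gK z Uz).2; have := coord_le_enorm (gradient g z) j.
  by rewrite mxE.
exists K, (Num.max 0 (Num.max C (2 * K / r))); split.
- by rewrite le_max lexx.
- by move=> x /OU /gK[].
- move=> x y Kx Ky; have [xyr|xyr] := ltP `|x - y| r.
    by apply: le_trans (HC x y Kx Ky xyr) _; rewrite ler_wpM2r// !le_max lexx orbT.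
  have [gx _] := gK x (OU _ Kx); have [gy _] := gK y (OU _ Ky).
  have K0 : 0 <= K by apply: le_trans gx.
  apply: (@le_trans _ _ (2 * K)).
    by apply: le_trans (ler_normB _ _) _; lra.
  apply: (@le_trans _ _ (2 * K / r * `|x - y|)).
    by rewrite -[leLHS](@divfK _ r) ?gt_eqF// ler_wpM2l// divr_ge0 ?mulr_ge0// ltW.
  by rewrite ler_wpM2r// !le_max lexx !orbT.
Qed.

(** * Changes of time along a curve *)

Lemma disjoint_itv_homo (R : realType) (eta : R -> R) (N : nat) (l r : 'I_N -> R) :
  {homo eta : x y / x <= y} -> trivIset setT (fun k => `](l k), (r k)[%classic) ->
  (forall k, l k <= r k) ->
  trivIset setT (fun k => `](eta (l k)), (eta (r k))[%classic).
Proof.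
move=> eta_nd tI lr; apply/trivIsetP => i j _ _ ij.
have := trivIsetP.1 tI i j I I ij; rewrite -!subset0 => disj x /= [].
rewrite !in_itv /= => /andP[i1 i2] /andP[j1 j2].
have lt_of u v : eta u < eta v -> u < v.
  by move=> uv; rewrite ltNge; apply/negP => /eta_nd; rewrite leNgt uv.
pose a := Num.max (l i) (l j); pose b := Num.min (r i) (r j).
have ab : a < b.
  rewrite lt_min !gt_max (lt_of _ _ (lt_trans i1 i2)) (lt_of _ _ (lt_trans j1 i2)).
  by rewrite (lt_of _ _ (lt_trans i1 j2)) (lt_of _ _ (lt_trans j1 j2)).
have [a1 a2] : l i <= a /\ l j <= a by rewrite !le_max !lexx orbT.
have [b1 b2] : b <= r i /\ b <= r j by rewrite !ge_min !lexx orbT.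
by apply: (disj ((a + b) / 2)); split => /=; rewrite in_itv /=; apply/andP; split; lra.
Qed.

(** Reparametrizing by a monotone Lipschitz change of time and adding a
    Lipschitz curve preserve absolute continuity. *)
Lemma absolutely_continuous_glue (R : realType) (n : nat) (T k M : R)
    (gamma q : R -> 'rV[R]_n) (eta : R -> R) (x : 'rV[R]_n) :
  0 <= k -> 0 <= M -> absolutely_continuous 0 T gamma ->
  {homo eta : s r / s <= r} ->
  (forall s, 0 <= s <= T -> 0 <= eta s <= T) ->
  (forall s r, s <= r -> eta r - eta s <= k * (r - s)) ->
  (forall s r, `|q s - q r| <= M * `|s - r|) ->
  absolutely_continuous 0 T (fun s => q s + gamma (eta s) - x).
Proof.
move=> k0 M0 acg eta_nd etaT etak qM e e0.
have n1 : 0 < n%:R + 1 :> R by rewrite ltr_wpDl.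
have k1 : 0 < k + 1 by rewrite ltr_wpDl.
have nM0 : 0 <= n%:R * M by rewrite mulr_ge0.
have nM1 : 0 < 2 * (n%:R * M + 1) by rewrite mulr_gt0// ltr_wpDl.
have e1 : 0 < e / (2 * (n%:R + 1)) by rewrite divr_gt0// mulr_gt0.
have [d d0 gd] := acg _ e1.
exists (Num.min (d / (k + 1)) (e / (2 * (n%:R * M + 1)))).
  by rewrite lt_min !divr_gt0.
move=> N l r lr tI; rewrite lt_min => /andP[sd se].
set S := \sum_(i < N) (r i - l i) in sd se.
have lrk i : l i <= r i by case/and3P: (lr i).
have S0 : 0 <= S by apply: sumr_ge0 => i _; rewrite subr_ge0.
have h1 i : [&& 0 <= (eta \o l) i, (eta \o l) i <= (eta \o r) i & (eta \o r) i <= T].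
  have /and3P[l0 lri rT] := lr i.
  have /andP[-> _] := etaT (l i) (introT andP (conj l0 (le_trans lri rT))).
  have /andP[_ ->] := etaT (r i) (introT andP (conj (le_trans l0 lri) rT)).
  by rewrite andbT /= eta_nd.
have h2 : trivIset setT (fun i => `](eta \o l) i, (eta \o r) i[%classic).
  exact: disjoint_itv_homo.
have h3 : \sum_(i < N) ((eta \o r) i - (eta \o l) i) < d.
  apply: (@le_lt_trans _ _ (k * S)).
    by rewrite mulr_sumr; apply: ler_sum => i _; exact: etak.
  apply: (@le_lt_trans _ _ ((k + 1) * S)).
    by rewrite ler_wpM2r// lerDl.
  by rewrite mulrC -ltr_pdivlMr.
have := gd N _ _ h1 h2 h3 => H.
set G := \sum_(i < N) _ in H.
apply: (@le_lt_trans _ _ (n%:R * M * S + n%:R * G)).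
  rewrite !mulr_sumr -big_split /=; apply: ler_sum => i _.
  apply: le_trans (enorm_le_norm _) _; rewrite -mulrA -mulrDr ler_wpM2l//.
  have -> : q (r i) + gamma (eta (r i)) - x - (q (l i) + gamma (eta (l i)) - x) =
      (q (r i) - q (l i)) + (gamma (eta (r i)) - gamma (eta (l i))).
    by apply/rowP => j; rewrite !mxE; ring.
  apply: le_trans (ler_normD _ _) _; apply: lerD; last exact: norm_le_enorm.
  by apply: le_trans (qM _ _) _; rewrite ger0_norm// subr_ge0.
have H1 : n%:R * M * S <= e / 2.
  apply: (@le_trans _ _ ((n%:R * M + 1) * S)); first by rewrite ler_wpM2r// lerDl.
  move/ltW: se; rewrite ler_pdivlMr// => se.
  by move: se; set u := (_ + 1); rewrite mulrA (mulrC S) => se; lra.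
have H2 : n%:R * G < e / 2.
  have G0 : 0 <= G by apply: sumr_ge0 => i _; exact: enorm_ge0.
  apply: (@le_lt_trans _ _ ((n%:R + 1) * G)); first by rewrite ler_wpM2r// lerDl.
  move: H; rewrite ltr_pdivlMr//.
  by set u := (_ + 1); rewrite mulrA (mulrC G) => H; lra.
lra.
Qed.

Lemma derive1_affine (R : realType) (n : nat) (gamma : R -> 'rV[R]_n) (c k s : R) :
  derivable gamma (k * s + c) 1 ->
  is_derive s 1 (fun s => gamma (k * s + c)) (k *: derive1 gamma (k * s + c)).
Proof.
move=> /derivable1_diffP dg.
have E l : k * l + c = c + l *: (k : R) by rewrite addrC [l *: _]mulrC.
have dg' : differentiable gamma (c + s *: (k : R)) by rewrite -E.
have := is_derive_line dg'; rewrite -E.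
have -> : 'D_k gamma (k * s + c) = k *: derive1 gamma (k * s + c).
  rewrite derive1E !deriveE// -[X in 'd _ _ X = _]mulr1.
  by rewrite -[k * 1]/(k *: (1 : R)) linearZ.
by under eq_fun do rewrite -E.
Qed.

Lemma derive1_lipschitz_le (R : realType) (n : nat) (eta : R -> 'rV[R]_n) (s M : R) :
  derivable eta s 1 -> (\forall r \near s, `|eta r - eta s| <= M * `|r - s|) ->
  `|derive1 eta s| <= M.
Proof.
move=> deta near_lip.
have cv : h^-1 *: (eta (h + s) - eta s) @[h --> 0^'] --> derive1 eta s.
  rewrite derive1E; move: deta; rewrite /derivable /derive.
  by under eq_fun do rewrite [_%:A]mulr1.
have : \forall h \near 0^', `|h^-1 *: (eta (h + s) - eta s)| <= M.
  have : \forall h \near 0^', `|eta (h + s) - eta s| <= M * `|h + s - s|.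
    have hs : h + s @[h --> (0 : R)] --> s.
      by rewrite -[X in _ --> X]add0r; apply: cvgD; [exact: cvg_id|exact: cvg_cst].
    by apply: cvg_within; exact: (hs _ near_lip).
  move=> h1; near=> h.
  have h0 : h != 0 by near: h; exact: nbhs_dnbhs_neq.
  rewrite normrZ normfV ler_pdivrMl ?normr_gt0// mulrC.
  by near: h; apply: filterS h1 => h; rewrite addrK.
by move=> nM; exact: cvgr_to_le (cvg_norm cv) nM.
Unshelve. all: by end_near. Qed.

(** * Cost and energy of a curve *)

Lemma lebesgue_measure_oo_off_null (R : realType) (a b : R) (N : set R) :
  a <= b -> measurable N -> lebesgue_measure N = 0%E ->
  lebesgue_measure (`]a, b[ `\` N) = (b - a)%:E.
Proof.
move=> ab mN N0.
have mI : measurable (`]a, b[%classic : set (measurableTypeR R)) by [].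
have mIN : measurable (`]a, b[ `&` N : set (measurableTypeR R)) by exact: measurableI.
have I0 : lebesgue_measure (`]a, b[ `&` N) = 0%E.
  apply/eqP; rewrite eq_le measure_ge0 andbT -[leRHS]N0.
  by apply: le_measure; rewrite ?inE//; exact: subIsetr.
have E : lebesgue_measure `]a, b[%classic = lebesgue_measure (`]a, b[ `\` N).
  rewrite [LHS](measureDI _ mI mN) [X in (_ + X)%E](_ : _ = 0%E) ?adde0//.
rewrite -[LHS]E.
rewrite lebesgue_measure_itv /= lte_fin; case: ltP => // ba.
by have -> : a = b; [apply/eqP; rewrite eq_le ab ba|rewrite subrr].
Qed.

Lemma integrable_cst_finite d (T : measurableType d) (R : realType)
    (mu : {measure set T -> \bar R}) (D : set T) (k : R) :
  measurable D -> (mu D < +oo)%E -> mu.-integrable D (EFin \o cst k).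
Proof.
move=> mD muD; apply/integrableP; split.
  by apply/measurable_EFinP; exact: measurable_cst.
rewrite (_ : (fun x => _) = cst `|k|%:E)//.
by rewrite integral_cst// lte_mul_pinfty// lee_fin.
Qed.

(** The Lagrangian and the squared speed along a curve. *)
Definition running_cost (R : realType) (n : nat)
    (f : R -> 'rV[R]_n -> 'rV[R]_n -> R) (gamma : R -> 'rV[R]_n) (s : R) : R :=
  f s (gamma s) (derive1 gamma s).

Definition sqr_speed (R : realType) (n : nat) (gamma : R -> 'rV[R]_n) (s : R) : R :=
  dotr (derive1 gamma s) (derive1 gamma s).

Lemma null_setU2 (R : realType) (N : set R) (a b : R) :
  measurable N /\ lebesgue_measure N = 0%E ->
  measurable (N `|` [set a] `|` [set b]) /\
  lebesgue_measure (N `|` [set a] `|` [set b]) = 0%E.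
Proof.
move=> [mN N0].
have mNa : measurable (N `|` [set a]) by exact: measurableU.
split; first exact: measurableU.
by rewrite !measureU0//; exact: lebesgue_measure_set1.
Qed.

(** Off the null set [N] the curve is differentiable, and its cost is an integral
    over a set where the integrand is measurable. The displacement estimate
    integrates [`|w| <= a * w ^+ 2 + 1 / (4 * a)]. *)
Lemma curve_data (R : realType) (n : nat) (T t : R) (Omega U : set 'rV[R]_n)
    (f : R -> 'rV[R]_n -> 'rV[R]_n -> R) (g : 'rV[R]_n -> R)
    (gamma : R -> 'rV[R]_n) :
  hyp_f0 T U f -> closure Omega `<=` U -> admissible T Omega gamma ->
  0 <= t -> t < T ->
  exists N : set R, let D := `]t, T[ `\` N in
  [/\ measurable N /\ lebesgue_measure N = 0%E,
      forall s, D s -> derivable gamma s 1,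
      measurable_fun D (running_cost f gamma) /\ measurable_fun D (sqr_speed gamma),
      cost T f g t gamma =
        (\int[lebesgue_measure]_(s in D) (running_cost f gamma s)%:E
         + (g (gamma T))%:E)%E &
      lebesgue_measure.-integrable D (EFin \o sqr_speed gamma) ->
      forall a, 0 < a -> `|gamma T - gamma t| <=
        a * (\int[lebesgue_measure]_(s in D) sqr_speed gamma s)%R + (T - t) / (4 * a)].
Proof.
move=> [cf _ _ _ _] OU [acg gO] t0 tT; have T0 : 0 < T by apply: le_lt_trans tT.
have [N [w [[mN N0] wi dg gw]]] := absolutely_continuous_derivative T0 acg.
have gU s : 0 <= s <= T -> U (gamma s) by move=> sT; apply/OU/gO; rewrite in_itv.
have dg' s : 0 < s < T -> ~ N s -> derivable gamma s 1 by move=> sT Ns; have [] := dg s sT Ns.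
have [F mF FE] := measurable_along_curve T0 acg gU mN dg' cf.
exists N => D.
have mD : measurable (D : set (measurableTypeR R)) by exact: measurableD.
have DT s : D s -> 0 < s < T /\ ~ N s.
  by move=> []; rewrite /= in_itv /= => /andP[ts sT] Ns; rewrite (le_lt_trans t0 ts) sT.
have GE s : D s -> sqr_speed gamma s = \sum_(i < n) w i s ^+ 2.
  move=> /DT[sT Ns]; rewrite /sqr_speed /dotr; apply: eq_bigr => i _.
  by have [_ ->] := dg s sT Ns; rewrite expr2.
split => //.
- by move=> s /DT[sT Ns]; exact: dg'.
- split.
    apply: (@eq_measurable_fun _ _ _ _ D F); last exact: measurable_funTS.
    by move=> s /set_mem/DT[sT Ns]; rewrite FE.
  apply: (@eq_measurable_fun _ _ _ _ D (fun s => \sum_(i < n) w i s ^+ 2)).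
    by move=> s /set_mem /GE ->.
  apply: measurable_sum => i; apply: measurable_funX.
  apply: measurable_funTS.
  by have /integrableP[/measurable_EFinP] := wi i.
- rewrite /cost; congr (_ + _)%E.
  have [mN2 N20] := null_setU2 t T (conj mN N0).
  apply: (@eq_integral_off_null_set _ _ _ (@lebesgue_measure R) _ _ (N `|` [set t] `|` [set T])) => // s.
  move=> /not_orP[/not_orP[Ns st] sT].
  rewrite /patch; congr (if _ then _ else _).
  apply/idP/idP => /set_mem h; apply/mem_set.
    split => //=; move: h; rewrite /= !in_itv /= => /andP[h1 h2].
    by rewrite !lt_neqAle h1 h2 !andbT; apply/andP; split; apply/eqP => // /esym.
  by case: h => /= + _; rewrite !in_itv /= => /andP[/ltW -> /ltW ->].
- move=> iG a a0.
  have muD : lebesgue_measure D = (T - t)%:E by apply: lebesgue_measure_oo_off_null => //; exact: ltW.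
  have muDy : (lebesgue_measure D < +oo)%E by rewrite muD ltry.
  have IG0 : 0 <= (\int[lebesgue_measure]_(s in D) sqr_speed gamma s)%R.
    by apply: Rintegral_ge0 => s _; exact: dotr_ge0.
  apply: norm_le_coord => [|i].
    have a0' := ltW a0; have tT' : 0 <= T - t by rewrite subr_ge0 ltW.
    by apply: addr_ge0; [exact: mulr_ge0|rewrite divr_ge0// mulr_ge0].
  rewrite !mxE (gw i t T t0 (ltW tT) (lexx T)).
  have wiD : lebesgue_measure.-integrable D (EFin \o w i) by exact: integrableS (wi i).
  have -> : (\int[lebesgue_measure]_(s in `]t, T]) w i s =
      \int[lebesgue_measure]_(s in D) w i s)%R.
    rewrite /Rintegral; congr fine.
    have [mN2 N20] := null_setU2 t T (conj mN N0).
    apply: (@eq_integral_off_null_set _ _ _ (@lebesgue_measure R) _ _ (N `|` [set t] `|` [set T])) => // s.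
    move=> /not_orP[/not_orP[Ns st] sT].
    rewrite /patch; congr (if _ then _ else _).
    apply/idP/idP => /set_mem h; apply/mem_set.
      split => //=; move: h; rewrite /= !in_itv /= => /andP[h1 h2].
      by rewrite h1 lt_neqAle h2 andbT; apply/eqP.
    by case: h => /= + _; rewrite !in_itv /= => /andP[-> /ltW ->].
  apply: le_trans (le_normr_Rintegral _ wiD) _ => //.
  have icst : lebesgue_measure.-integrable D (EFin \o cst (1 / (4 * a))).
    exact: integrable_cst_finite.
  have iaG : lebesgue_measure.-integrable D (EFin \o (fun s => a * sqr_speed gamma s)).
    have := integrableZl mD a iG; by apply: eq_integrable.
  have isum : lebesgue_measure.-integrable D
      (EFin \o (fun s => a * sqr_speed gamma s + 1 / (4 * a))).
    have := integrableD mD iaG icst; by apply: eq_integrable.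
  have iabs : lebesgue_measure.-integrable D (EFin \o (fun s => `|w i s|)).
    exact: integrable_norm.
  apply: le_trans (le_Rintegral mD iabs isum _) _.
    move=> s Ds; rewrite GE//.
    have : w i s ^+ 2 <= \sum_(j < n) w j s ^+ 2.
      by rewrite (bigD1 i)//= lerDl sumr_ge0// => j _; exact: sqr_ge0.
    move=> /(ler_wpM2l (ltW a0)) h; apply: le_trans (lerD h (lexx _)).
    rewrite -(real_normK (num_real (w i s))).
    have : 0 <= (2 * a * `|w i s| - 1) ^+ 2 / (4 * a).
      by rewrite divr_ge0 ?sqr_ge0// mulr_ge0// ltW.
    have -> : (2 * a * `|w i s| - 1) ^+ 2 / (4 * a) =
      a * `|w i s| ^+ 2 + 1 / (4 * a) - `|w i s| by field; rewrite gt_eqF.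
    by rewrite subr_ge0.
  rewrite RintegralD// RintegralZl// lerD2l.
  rewrite Rintegral_cst// [X in _ * X](_ : _ = T - t); last exact: (congr1 fine muD).
  by rewrite div1r mulrC.
Qed.

(** * Cost of curves and of detours *)

Section value_function.
Context {R : realType} {n : nat}.
Variables (T : R) (Omega U : set 'rV[R]_n)
  (f : R -> 'rV[R]_n -> 'rV[R]_n -> R) (g : 'rV[R]_n -> R) (c C Lg : R).
Hypotheses (OU : closure Omega `<=` U) (f0 : hyp_f0 T U f)
  (c0 : 0 < c) (C0 : 0 <= C) (Lg0 : 0 <= Lg).
(* The conclusion of [lagrangian_bounds]. *)
Hypothesis f_bounds : forall t x v, t \in `[0, T] -> U x ->
  [/\ c * dotr v v - C <= f t x v, f t x v <= C * (1 + dotr v v),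
      forall k, 1 <= k <= 2 ->
        f t x (k *: v) <= f t x v + C * (1 + dotr v v) * (k - 1) &
      forall s, s \in `[0, T] ->
        f t x v <= f s x v + C * (1 + dotr v v) * `|t - s|].
Hypothesis g_lip : forall x y, closure Omega x -> closure Omega y ->
  `|g x - g y| <= Lg * `|x - y|.

Let integral_cst_cc t (k : R) : t <= T ->
  (\int[lebesgue_measure]_(s in `[t, T]) k%:E)%E = (k * (T - t))%:E.
Proof.
move=> tT; have E : lebesgue_measure `[t, T]%classic = (T - t)%:E.
  rewrite lebesgue_measure_itv /= lte_fin; case: ltP => // Tt.
  by have -> : t = T; [apply/eqP; rewrite eq_le tT Tt|rewrite subrr].
have := @integral_cst _ _ R (@lebesgue_measure R) _ (measurable_itv `[t, T]) k%:E.
by rewrite [X in (_ * X)%E](_ : _ = (T - t)%:E)// => ->; rewrite EFinM.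
Qed.

Let in_domain gamma t s : admissible T Omega gamma -> 0 <= t -> t <= s <= T ->
  s \in `[0, T] /\ U (gamma s).
Proof.
move=> [_ gO] t0 /andP[ts sT]; have sT' : s \in `[0, T].
  by rewrite in_itv /= sT (le_trans t0 ts).
by split => //; apply/OU/gO.
Qed.

Lemma cost_lower_bound t gamma : 0 <= t -> t <= T -> admissible T Omega gamma ->
  ((g (gamma T) - C * (T - t))%:E <= cost T f g t gamma)%E.
Proof.
move=> t0 tT adm; rewrite /cost addrC EFinD leeD2r// -mulNr -integral_cst_cc//.
apply: (@le_integral_off_null_set _ _ _ (@lebesgue_measure R) _ _ set0) => //.
move=> s _; rewrite /patch; case: ifPn => // /set_mem; rewrite /= in_itv /= => sT.
have [sT' Us] := in_domain adm t0 sT.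
have [lo _ _ _] := f_bounds (derive1 gamma s) sT' Us.
by rewrite lee_fin; apply: le_trans lo; rewrite lerDr mulr_ge0 ?dotr_ge0// ltW.
Qed.

Lemma cost_constant_curve t x : 0 <= t -> t <= T -> closure Omega x ->
  (cost T f g t (cst x) <= (g x + C * (T - t))%:E)%E.
Proof.
move=> t0 tT Kx; rewrite /cost [leRHS]EFinD [leRHS]addeC leeD2r// -integral_cst_cc//.
apply: (@le_integral_off_null_set _ _ _ (@lebesgue_measure R) _ _ set0) => //.
move=> s _; rewrite /patch; case: ifPn => // /set_mem; rewrite /= in_itv /= => /andP[ts sT].
have sT' : s \in `[0, T] by rewrite in_itv /= sT (le_trans t0 ts).
have [_ up _ _] := f_bounds 0 sT' (OU Kx).
rewrite lee_fin derive1_cst; apply: le_trans up _.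
by rewrite /dotr big1 ?addr0 ?mulr1// => i _; rewrite mxE mul0r.
Qed.

Lemma admissible_cst x : closure Omega x -> admissible T Omega (cst x).
Proof.
move=> Kx; split => // e e0; exists 1 => // N l r _ _ _.
by rewrite big1// => i _; rewrite /enorm /dotr subrr big1 ?sqrtr0// => j _; rewrite mxE mul0r.
Qed.

(** The energy is controlled by the excess of the cost over [g] at the starting
    point. The variation of [g] along the curve costs at most [Lg] times the
    displacement, of which the coercivity of the Lagrangian absorbs the part
    that is quadratic in the speed. *)
Lemma curve_energy t gamma r : 0 <= t -> t < T -> admissible T Omega gamma ->
  cost T f g t gamma = r%:E ->
  exists N : set R, let D := `]t, T[ `\` N in
    let IF := (\int[lebesgue_measure]_(s in D) running_cost f gamma s)%R in
    let IG := (\int[lebesgue_measure]_(s in D) sqr_speed gamma s)%R in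
  [/\ measurable N /\ lebesgue_measure N = 0%E,
      forall s, D s -> derivable gamma s 1,
      lebesgue_measure.-integrable D (EFin \o running_cost f gamma) /\
      lebesgue_measure.-integrable D (EFin \o sqr_speed gamma),
      r = IF + g (gamma T) /\ - C * (T - t) <= IF &
      c / 2 * IG <= r - g (gamma t) + (C + Lg * (Lg + 1) / (2 * c)) * (T - t)].
Proof.
move=> t0 tT adm cr.
have [N [N0 dg [mF mG] cE disp]] := curve_data g f0 OU adm t0 tT.
exists N => D IF IG.
have mD : measurable (D : set (measurableTypeR R)) by apply: measurableD => //; case: N0.
have muD : lebesgue_measure D = (T - t)%:E.
  by case: N0 => mN N0; apply: lebesgue_measure_oo_off_null => //; exact: ltW.
have muDy : (lebesgue_measure D < +oo)%E by rewrite muD ltry.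
have Ddom s : D s -> s \in `[0, T] /\ U (gamma s).
  move=> [+ _]; rewrite /= in_itv /= => /andP[ts sT].
  by apply: (in_domain adm t0); rewrite !ltW.
have lo s : D s -> c * sqr_speed gamma s - C <= running_cost f gamma s.
  by move=> /Ddom[sT Us]; have [] := f_bounds (derive1 gamma s) sT Us.
have G0 s : 0 <= sqr_speed gamma s by exact: dotr_ge0.
have intF : (\int[lebesgue_measure]_(s in D) (running_cost f gamma s)%:E < +oo)%E.
  by rewrite ltey; apply/eqP => h; move: cr; rewrite cE -/D h addye.
have iF : lebesgue_measure.-integrable D (EFin \o running_cost f gamma).
  apply: (@integrable_bounded_below _ _ _ _ _ _ C) => // s Ds.
  apply: le_trans (lo s Ds); rewrite lerDr; apply: mulr_ge0 (G0 s); exact: ltW.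
have icst k : lebesgue_measure.-integrable D (EFin \o cst k).
  exact: integrable_cst_finite.
have iFC : lebesgue_measure.-integrable D
    (EFin \o (fun s => running_cost f gamma s + C)).
  have := integrableD mD iF (icst C); by apply: eq_integrable.
have iFCc : lebesgue_measure.-integrable D
    (EFin \o (fun s => c^-1 * (running_cost f gamma s + C))).
  have := integrableZl mD c^-1 iFC; by apply: eq_integrable.
have GF s : D s -> sqr_speed gamma s <= c^-1 * (running_cost f gamma s + C).
  move=> Ds; rewrite -ler_pdivrMl ?invr_gt0// invrK.
  by have := lo s Ds; rewrite lerBlDr.
have iG : lebesgue_measure.-integrable D (EFin \o sqr_speed gamma).
  apply: (le_integrable mD _ _ iFCc); first exact/measurable_EFinP.
  move=> s Ds; rewrite /= lee_fin ger0_norm ?G0//.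
  by apply: le_trans (GF s Ds) _; exact: ler_norm.
have muDr : fine (lebesgue_measure D) = T - t by rewrite muD.
have Ile : c * IG - C * (T - t) <= IF.
  have := le_Rintegral mD iG iFCc GF.
  rewrite RintegralZl// RintegralD//; last exact: (icst C).
  rewrite Rintegral_cst// -/IF -/IG.
  rewrite -ler_pdivrMl ?invr_gt0// invrK.
  rewrite [X in _ <= _ + C * X](_ : _ = T - t); last exact: muDr.
  by rewrite lerBlDr.
have rE : r = IF + g (gamma T).
  apply: EFin_inj; rewrite -cr cE -/D EFinD; congr (_ + _)%E.
  rewrite /IF /Rintegral fineK//; exact: integrable_fin_num.
have IG0 : 0 <= IG by apply: Rintegral_ge0.
split => //.
  by split => //; rewrite mulNr; apply: le_trans Ile; rewrite lerDr mulr_ge0// ltW.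
have L1 : 0 < Lg + 1 by rewrite ltr_wpDl.
(* With this weight, the energy enters the bound on the variation of [g]
   with a factor at most [c / 2]. *)
have a0 : 0 < c / (2 * (Lg + 1)) by rewrite divr_gt0// mulr_gt0.
have := disp iG _ a0; rewrite -/D -/IG => dle.
have [_ gO] := adm; have T0 : 0 <= T by apply: le_trans t0 (ltW tT).
have gT : closure Omega (gamma T) by apply: gO; rewrite in_itv /= T0 lexx.
have gt : closure Omega (gamma t) by apply: gO; rewrite in_itv /= t0 ltW.
have := g_lip gT gt; rewrite ler_norml => /andP[gl _].
have h1 : Lg * `|gamma T - gamma t| <=
    c / 2 * IG + Lg * (Lg + 1) / (2 * c) * (T - t).
  apply: le_trans (ler_wpM2l Lg0 dle) _.
  have -> : Lg * (c / (2 * (Lg + 1)) * IG + (T - t) / (4 * (c / (2 * (Lg + 1))))) =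
     (Lg / (Lg + 1)) * (c / 2 * IG) + Lg * (Lg + 1) / (2 * c) * (T - t).
    by field; rewrite !gt_eqF.
  rewrite lerD2r ler_piMl//; first by rewrite mulr_ge0// divr_ge0// ltW.
  by rewrite ler_pdivrMr// mul1r lerDl.
have h2 : c * IG = c / 2 * IG + c / 2 * IG by field.
rewrite h2 in Ile; rewrite rE mulrDl.
have arith (x1 x2 x3 p q w y : R) : - w <= p - q -> w <= x1 + x3 ->
  x1 + x1 - x2 <= y -> x1 <= y + p - q + (x2 + x3) by lra.
exact: arith gl h1 Ile.
Qed.


Section competitor.
Variables (t t' d L : R) (gamma : R -> 'rV[R]_n) (y : 'rV[R]_n).
Hypotheses (t0 : 0 <= t) (tT : t < T) (t'0 : 0 <= t') (d0 : 0 < d) (L0 : 0 <= L)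
  (adm : admissible T Omega gamma) (tt'd : `|t - t'| <= d)
  (xyd : `|gamma t - y| <= d) (dT : 4 * d <= T - t).
Variable p : R -> 'rV[R]_n.
Hypotheses (p0 : p 0 = y) (p1 : p 1 = gamma t)
  (pK : forall l, 0 <= l <= 1 -> closure Omega (p l))
  (plip : forall l k, 0 <= l <= 1 -> 0 <= k <= 1 ->
    `|p l - p k| <= L * `|gamma t - y| * `|l - k|).

(* Up to the time [t1] the competitor follows [p]; afterwards it runs through
   [gamma] at [k] times its speed, so as to be at [gamma T] at time [T]. *)
Let t1 := t' + d.
Let k := (T - t) / (T - t1).
Let theta (s : R) := k * s + (t - k * t1).
Let q (s : R) := p (clamp 1 ((s - t') / d)).

(** The competitor for the initial time [t'] and point [y]. The sum is [q s] for
    [s <= t1], where the second term is [gamma t], and [gamma (theta s)] for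
    [t1 <= s], where [q s] is [gamma t]. *)
Definition detour (s : R) : 'rV[R]_n :=
  q s + gamma (theta (Num.max s t1)) - gamma t.

Let t1_bounds : t <= t1 /\ t1 <= t + 2 * d.
Proof. by move: tt'd; rewrite /t1 ler_norml; lra. Qed.

Let Tt1 : 0 < T - t1.
Proof. by have [h1 h2] := t1_bounds; move: dT d0 h2; lra. Qed.

Let k_ge1 : 1 <= k.
Proof. by rewrite /k ler_pdivlMr// mul1r; have [] := t1_bounds; lra. Qed.

Let k_bound : k - 1 <= 4 * d / (T - t).
Proof.
have [h1 h2] := t1_bounds.
have Tt : 0 < T - t by rewrite subr_gt0.
have -> : k - 1 = (t1 - t) / (T - t1) by rewrite /k; field; rewrite gt_eqF.
rewrite ler_pdivrMr// mulrAC ler_pdivlMr//.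
have : (t1 - t) * (T - t) <= (2 * d) * (2 * (T - t1)).
  by have d0' := d0; have dT' := dT; apply: ler_pM; lra.
by lra.
Qed.

Let k_le2 : k <= 2.
Proof.
have Tt : 0 < T - t by rewrite subr_gt0.
have : 4 * d / (T - t) <= 1 by rewrite ler_pdivrMr// mul1r.
by have := k_bound; lra.
Qed.

Let k0 : 0 < k. Proof. exact: lt_le_trans k_ge1. Qed.

Let theta_nd : {homo theta : s r / s <= r}.
Proof. by move=> s r sr; rewrite /theta lerD2r ler_wpM2l// ltW. Qed.

Let theta_t1 : theta t1 = t. Proof. by rewrite /theta; ring. Qed.

Let theta_T : theta T = T.
Proof. by rewrite /theta /k; field; rewrite gt_eqF. Qed.

Let theta_dist s : t1 <= s <= T -> `|s - theta s| <= 2 * d.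
Proof.
move=> /andP[s1 sT]; have [h1 h2] := t1_bounds; have d0' := d0; have dT' := dT; have Tt1' := Tt1.
have E : s - theta s = (t1 - t) * ((T - s) / (T - t1)).
  by rewrite /theta /k; field; rewrite gt_eqF.
have u0 : 0 <= (T - s) / (T - t1) by rewrite divr_ge0 ?subr_ge0 // -subr_ge0 ltW.
have u1 : (T - s) / (T - t1) <= 1 by rewrite ler_pdivrMr// mul1r; lra.
rewrite E ger0_norm; last by rewrite mulr_ge0// subr_ge0.
have : (t1 - t) * ((T - s) / (T - t1)) <= (t1 - t) * 1.
  by rewrite ler_wpM2l// subr_ge0.
by lra.
Qed.

Let clamp_lip (x z : R) : `|clamp 1 x - clamp 1 z| <= `|x - z|.
Proof.
wlog xz : x z / z <= x.
  move=> H; case: (leP z x) => [/H//|/ltW/H]; by rewrite distrC (distrC z).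
rewrite !ger0_norm ?subr_ge0//; last exact: clamp_nd.
exact: clampB.
Qed.

Let q_lip s r : `|q s - q r| <= L * `|s - r|.
Proof.
apply: le_trans (plip (clamp_itv ler01 _) (clamp_itv ler01 _)) _.
apply: (@le_trans _ _ (L * d * `|clamp 1 ((s - t') / d) - clamp 1 ((r - t') / d)|)).
  by rewrite ler_wpM2r// ler_wpM2l.
rewrite -mulrA ler_wpM2l//.
apply: le_trans (ler_wpM2l (ltW d0) (clamp_lip _ _)) _.
rewrite -mulrBl opprB addrA subrK normrM normfV (gtr0_norm d0).
by rewrite mulrC mulfVK// gt_eqF.
Qed.

Let detour_before s : s <= t1 -> detour s = q s.
Proof. by move=> st; rewrite /detour (max_idPr st) theta_t1 addrK. Qed.

Let detour_after s : t1 <= s -> detour s = gamma (theta s).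
Proof.
move=> st; rewrite /detour (max_idPl st) /q.
have -> : clamp 1 ((s - t') / d) = 1.
  rewrite /clamp (min_idPl _) ?(max_idPr ler01)//.
  by rewrite ler_pdivlMr// mul1r; move: st; rewrite /t1; lra.
by rewrite p1 addrAC subrr add0r.
Qed.

Lemma detour_start : detour t' = y.
Proof.
rewrite detour_before; last by rewrite /t1 lerDl ltW.
by rewrite /q subrr mul0r clamp_id// lexx ler01.
Qed.

Lemma detour_end : detour T = gamma T.
Proof. by rewrite detour_after ?theta_T//; have := Tt1; lra. Qed.

Lemma detour_admissible : admissible T Omega detour.
Proof.
have [acg gO] := adm.
have etaT s : 0 <= s <= T -> 0 <= theta (Num.max s t1) <= T.
  move=> /andP[s0 sT]; apply/andP; split.
    apply: (le_trans t0); rewrite -theta_t1; apply: theta_nd.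
    by rewrite le_max lexx orbT.
  rewrite -[leRHS]theta_T; apply: theta_nd; rewrite ge_max sT /=.
  by have := Tt1; lra.
split.
  apply: (@absolutely_continuous_glue _ _ _ k L gamma q
    (fun s => theta (Num.max s t1))) => //.
  - exact: ltW.
  - by move=> s r sr; apply: theta_nd; rewrite ge_max !le_max lexx sr !orbT.
  - move=> s r sr; rewrite /theta opprD addrACA subrr addr0 -mulrBr.
    rewrite ler_wpM2l//; first exact: ltW.
    by case: (leP s t1) => ?; case: (leP r t1) => ?; lra.
move=> s sT; have [st|st] := leP s t1.
  by rewrite detour_before//; apply/pK/clamp_itv.
rewrite detour_after ?ltW//; apply: gO; rewrite in_itv /=.
by have := etaT s; rewrite (max_idPl (ltW st)); apply; rewrite in_itv in sT.
Qed.

Let detour_speed_before s : t' < s -> s < t1 -> derivable detour s 1 ->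
  sqr_speed detour s <= (n%:R * L) ^+ 2.
Proof.
move=> ts st ds; rewrite /sqr_speed -sqr_enorm lerXn2r ?nnegrE ?enorm_ge0 ?mulr_ge0//.
apply: le_trans (enorm_le_norm _) _; rewrite ler_wpM2l//.
apply: derive1_lipschitz_le => //; near=> r.
have rt : r <= t1 by apply/ltW; near: r; exact: lt_nbhsl.
by rewrite !detour_before ?(ltW st)//; exact: q_lip.
Unshelve. all: by end_near. Qed.

Let detour_speed_after s : t1 < s -> derivable gamma (theta s) 1 ->
  derive1 detour s = k *: derive1 gamma (theta s).
Proof.
move=> st dg.
have near_eq : {near s, (fun s => gamma (theta s)) =1 detour}.
  near=> r; rewrite detour_after//.
  by apply/ltW; near: r; exact: lt_nbhsr.
have [_ <-] := near_eq_is_derive near_eq (derive1_affine dg).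
by rewrite derive1E.
Unshelve. all: by end_near. Qed.

Let lt_theta s r : theta s < theta r -> s < r.
Proof. by move=> sr; rewrite ltNge; apply/negP => /theta_nd; rewrite leNgt sr. Qed.

Let theta_lt s r : s < r -> theta s < theta r.
Proof. by move=> sr; rewrite /theta ltrD2r ltr_pM2l. Qed.

(* [kappa] bounds the sum of the delay [`|s - theta s|] and of [k - 1]. *)
Let kappa := 2 * d + 4 * d / (T - t).

Let kappa_ge0 : 0 <= kappa.
Proof. by rewrite addr_ge0 ?divr_ge0 ?mulr_ge0 ?subr_ge0// ltW. Qed.

Let after_cost s : t1 < s -> s < T -> derivable gamma (theta s) 1 ->
  running_cost f detour s <= running_cost f gamma (theta s) +
    C * kappa * (1 + sqr_speed gamma (theta s)).
Proof.
move=> s1 sT dg; rewrite /running_cost detour_speed_after// detour_after; last exact: ltW.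
have [h1 h2] := t1_bounds.
have sT' : s \in `[0, T].
  by rewrite in_itv /= (ltW sT) andbT; have := t0; move: s1 h1; lra.
have thT : theta s \in `[0, T].
  rewrite in_itv /=; apply/andP; split.
    by apply: (le_trans t0); rewrite -theta_t1; apply/theta_nd/ltW.
  by rewrite -[leRHS]theta_T; apply/theta_nd/ltW.
have UO : U (gamma (theta s)) by apply: OU; have [_] := adm; apply.
set v := derive1 gamma (theta s).
have [_ _ /(_ k) hk hs] := f_bounds v sT' UO.
have {}hk := hk (introT andP (conj k_ge1 k_le2)).
have {}hs := hs _ thT.
rewrite /sqr_speed -/v; have E0 := dotr_ge0 v; move: (dotr v v) E0 hk hs => E E0 hk hs.
have dist : `|s - theta s| <= 2 * d by apply: theta_dist; rewrite !ltW.
have CE : 0 <= C * (1 + E) by rewrite mulr_ge0// addr_ge0.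
have h3 := ler_wpM2l CE dist; have h4 := ler_wpM2l CE k_bound.
have -> : C * kappa * (1 + E) = C * (1 + E) * (2 * d) + C * (1 + E) * (4 * d / (T - t)).
  by rewrite /kappa; ring.
have arith (a b e1 e2 e3 x1 x2 : R) : a <= b + x1 -> b <= e1 + x2 -> x1 <= e2 ->
  x2 <= e3 -> a <= e1 + (e3 + e2) by lra.
exact: arith hk hs h4 h3.
Qed.

(** When the energy of [gamma] on [[t, T]] is of the order of [T - t], the detour
    costs at most a constant times [d] more: its first part has bounded speed
    and lasts [d], and the errors on the second part are proportional to
    [d / (T - t)] times the sum of [T - t] and of the energy. *)
Lemma detour_cost (r B : R) : cost T f g t gamma = r%:E -> 0 <= B ->
  r - g (gamma t) + (C + Lg * (Lg + 1) / (2 * c)) * (T - t) <= B * (T - t) ->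
  (cost T f g t' detour <= (r + (C * (1 + (n%:R * L) ^+ 2) + 2 * C +
     C * (2 * T + 4) * (1 + 2 * B / c)) * d)%:E)%E.
Proof.
move=> cr B0 rB.
have Tt : 0 < T - t by rewrite subr_gt0.
have T0 : 0 < T by apply: le_lt_trans tT.
have [N] := curve_energy t0 tT adm cr.
cbv zeta.
set D := `]t, T[ `\` N.
move=> [[mN N0] dgN [iF iG] [rE IFlo] Eb].
set IF := (\int[lebesgue_measure]_(s in D) running_cost f gamma s)%R in rE IFlo Eb.
set IG := (\int[lebesgue_measure]_(s in D) sqr_speed gamma s)%R in rE IFlo Eb.
have [N' [w [[mN' N'0] _ dd _]]] :=
  absolutely_continuous_derivative T0 detour_admissible.1.
have mD : measurable (D : set (measurableTypeR R)) by exact: measurableD.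
have muD : lebesgue_measure D = (T - t)%:E.
  by apply: lebesgue_measure_oo_off_null => //; exact: ltW.
have muDy : (lebesgue_measure D < +oo)%E by rewrite muD ltry.
pose H s := running_cost f gamma s + C * kappa * (1 + sqr_speed gamma s).
have icst a : lebesgue_measure.-integrable D (EFin \o cst a).
  exact: integrable_cst_finite.
have i1G : lebesgue_measure.-integrable D (EFin \o (fun s => 1 + sqr_speed gamma s)).
  have := integrableD mD (icst 1) iG; by apply: eq_integrable.
have iCG : lebesgue_measure.-integrable D
    (EFin \o (fun s => C * kappa * (1 + sqr_speed gamma s))).
  have := integrableZl mD (C * kappa) i1G; by apply: eq_integrable.
have iH : lebesgue_measure.-integrable D (EFin \o H).
  have := integrableD mD iF iCG; by apply: eq_integrable.
have IH : (\int[lebesgue_measure]_(s in D) H s)%R = IF + C * kappa * (T - t + IG).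
  rewrite RintegralD// RintegralZl// RintegralD//; last exact: (icst 1).
  rewrite Rintegral_cst// mul1r -/IF -/IG; congr (_ + _ * (_ + _)).
  exact: (congr1 fine muD).
pose thD := theta @^-1` D.
pose c4 := C * (1 + (n%:R * L) ^+ 2).
pose Gt s := if s < t1 then c4 else H (theta s).
pose NN := N' `|` theta @^-1` N `|` [set t'] `|` [set t1] `|` [set T].
have mthN : measurable (theta @^-1` N) by exact: measurable_affine_preimage.
have thN0 : lebesgue_measure (theta @^-1` N) = 0%E.
  by rewrite /theta lebesgue_measure_affine// N0 mule0.
have [mNN NN0] : measurable NN /\ lebesgue_measure NN = 0%E.
  have [mA A0] : measurable (N' `|` theta @^-1` N) /\
      lebesgue_measure (N' `|` theta @^-1` N) = 0%E.
    by split; [exact: measurableU|rewrite measureU0].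
  have [mB B0'] := null_setU2 t' t1 (conj mA A0).
  split; first exact: measurableU.
  by rewrite measureU0//; exact: lebesgue_measure_set1.
have mthD : measurable (thD : set (measurableTypeR R)) by exact: measurable_affine_preimage.
have thDP s : thD s -> t1 < s /\ s < T.
  move=> [+ _]; rewrite /= in_itv /= => /andP[h1 h2].
  by split; apply: lt_theta; rewrite ?theta_t1 ?theta_T.
have t't1 : t' < t1 by rewrite /t1 ltrDl.
have t1T : t1 < T by rewrite -subr_gt0.
(* [Gt] bounds the running cost of the detour off a null set; [thD] consists
   of times after [t1], and [gamma] is differentiable at [theta s] for [s] in
   [thD]. *)
have step1 : (\int[lebesgue_measure]_(s in `[t', T]) (running_cost f detour s)%:E <=
    \int[lebesgue_measure]_(s in `]t', t1[ `|` thD) (Gt s)%:E)%E.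
  apply: (@le_integral_off_null_set _ _ _ (@lebesgue_measure R) _ _ NN) => // s.
  move=> /not_orP[/not_orP[/not_orP[/not_orP[N's thNs] st'] st1] sT].
  rewrite /patch; case: ifPn => [/set_mem|/negP] sI; last first.
    rewrite ifN//; apply/negP => /set_mem h; apply: sI; apply/mem_set.
    rewrite /= in_itv /=; case: h => [|/thDP[h1 h2]].
      by rewrite /= in_itv /= => /andP[/ltW -> h] /=; apply/ltW/(lt_trans h).
    by rewrite (ltW h2) andbT; apply/ltW/(lt_trans t't1).
  move: sI; rewrite /= in_itv /= => /andP[h1 h2].
  have {}h1 : t' < s by rewrite lt_neqAle h1 andbT; apply/eqP => /esym.
  have {}h2 : s < T by rewrite lt_neqAle h2 andbT; apply/eqP.
  have [s1|s1|//] := ltgtP s t1.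
    rewrite mem_set; last by left; rewrite /= in_itv /= h1 s1.
    rewrite /Gt s1 lee_fin /running_cost.
    have s0T : 0 < s < T by rewrite h2 andbT (le_lt_trans t'0 h1).
    have s0T' : s \in `[0, T] by rewrite in_itv /=; case/andP: s0T => /ltW -> /ltW ->.
    have UO : U (detour s) by apply: OU; have [_] := detour_admissible; apply.
    have [_ up _ _] := f_bounds (derive1 detour s) s0T' UO.
    apply: le_trans up _; rewrite /c4 ler_wpM2l// lerD2l.
    by apply: detour_speed_before => //; have [] := dd s s0T N's.
  have Ds : thD s.
    split => //=; rewrite in_itv /=.
    by have := theta_lt s1; have := theta_lt h2; rewrite theta_t1 theta_T => -> ->.
  rewrite mem_set; last by right.
  rewrite /Gt ltNge (ltW s1) /= lee_fin /H; apply: after_cost => //.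
  exact: dgN.
have mHth : measurable_fun thD (H \o theta).
  apply: measurable_fun_affine => //.
  by have /integrableP[/measurable_EFinP] := iH.
have GtE1 : {in `]t', t1[%classic, Gt =1 cst c4}.
  by move=> s /set_mem; rewrite /= in_itv /= /Gt => /andP[_ ->].
have GtE2 : {in thD, Gt =1 H \o theta}.
  by move=> s /set_mem/thDP[h _]; rewrite /Gt ltNge (ltW h).
have step2 : (\int[lebesgue_measure]_(s in `]t', t1[ `|` thD) (Gt s)%:E =
    (c4 * d + k^-1 * (IF + C * kappa * (T - t + IG)))%:E)%E.
  rewrite integral_setU//; last 2 first.
  - apply/measurable_EFinP/measurable_funU => //; split.
      by apply: (eq_measurable_fun (cst c4)) => [s sI|]; rewrite ?GtE1.
    by apply: (eq_measurable_fun (H \o theta)) => [s sI|]; rewrite ?GtE2.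
  - apply/disj_setPS => s [] /=; rewrite in_itv /= => /andP[_ h1] /thDP[h2 _].
    by have := lt_trans h1 h2; rewrite ltxx.
  rewrite EFinD; congr (_ + _)%E.
  - rewrite (eq_integral (cst c4%:E)); last by move=> s sI; rewrite GtE1.
    have E : lebesgue_measure `]t', t1[%classic = d%:E.
      by rewrite lebesgue_measure_itv /= lte_fin t't1 -EFinD /t1 addrAC subrr add0r.
    rewrite integral_cst// [X in (_ * X)%E](_ : _ = d%:E); last exact: E.
    by rewrite EFinM.
  - transitivity (\int[lebesgue_measure]_(s in thD) (EFin \o (H \o theta)) s)%E.
      by apply: eq_integral => s sI; rewrite GtE2.
    rewrite -IH -(@Rintegral_affine _ k (t - k * t1))// /Rintegral fineK//.
    apply: integrable_fin_num; first exact: mthD.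
    exact: (integrable_affine (t - k * t1) k0 mD iH).
have IG0 : 0 <= IG by apply: Rintegral_ge0 => s _; exact: dotr_ge0.
have IGle : IG <= 2 * B / c * (T - t).
  have h := le_trans Eb rB.
  have -> : IG = 2 / c * (c / 2 * IG) by field; rewrite gt_eqF.
  have -> : 2 * B / c * (T - t) = 2 / c * (B * (T - t)) by field; rewrite gt_eqF.
  by rewrite ler_wpM2l// divr_ge0// ltW.
have kV1 : k^-1 <= 1 by rewrite invf_le1.
have kV0 : 0 <= k^-1 by rewrite invr_ge0 ltW.
have kVE : (1 - k^-1) * (T - t) = t1 - t.
  by rewrite /k; field; rewrite !gt_eqF.
have kappaE : kappa * (T - t) = (2 * (T - t) + 4) * d.
  by rewrite /kappa; field; rewrite gt_eqF.
have B1 : 0 <= 1 + 2 * B / c.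
  by rewrite addr_ge0// divr_ge0 ?mulr_ge0// ltW.
have X0 : 0 <= C * kappa * (T - t + IG).
  by rewrite !mulr_ge0// addr_ge0// ltW.
have Xle : C * kappa * (T - t + IG) <= C * (2 * T + 4) * (1 + 2 * B / c) * d.
  apply: (@le_trans _ _ (C * (kappa * (T - t)) * (1 + 2 * B / c))).
    have -> : C * (kappa * (T - t)) * (1 + 2 * B / c) =
      C * kappa * (T - t + 2 * B / c * (T - t)) by ring.
    by rewrite ler_wpM2l ?mulr_ge0// lerD2l.
  rewrite kappaE (mulrA C) [leLHS]mulrAC; apply: ler_wpM2r; first exact: ltW.
  apply: ler_wpM2r => //; apply: ler_wpM2l => //.
  by rewrite lerD2r ler_wpM2l// gerBl.
have aX : k^-1 * (C * kappa * (T - t + IG)) <= C * kappa * (T - t + IG).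
  by rewrite ler_piMl.
have aF : k^-1 * IF <= IF + 2 * C * d.
  have h1 : 0 <= (1 - k^-1) * (IF + C * (T - t)).
    by rewrite mulr_ge0 ?subr_ge0// -lerBlDr sub0r -mulNr.
  have h2 : C * ((1 - k^-1) * (T - t)) <= C * (2 * d).
    by rewrite ler_wpM2l// kVE; have [_] := t1_bounds; rewrite lerBlDl.
  by lra.
rewrite /cost detour_end rE.
apply: (@le_trans _ _ ((c4 * d + k^-1 * (IF + C * kappa * (T - t + IG)))%:E +
    (g (gamma T))%:E)%E).
  by rewrite leeD2r// -step2.
rewrite -EFinD lee_fin mulrDr -/c4.
have arith (x1 x2 x3 x4 x5 x6 y1 y2 : R) : x2 <= x4 + y1 -> x3 <= y2 -> y2 <= x6 ->
  x1 + (x2 + x3) + x5 <= x4 + x5 + (x1 + y1 + x6) by lra.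
have := arith (c4 * d) _ _ _ (g (gamma T)) _ _ _ aF aX Xle.
by rewrite -!mulrDl.
Qed.

End competitor.

(** * Lipschitz continuity of the value *)

Variable Kg : R.
Hypothesis g_bound : forall x, closure Omega x -> `|g x| <= Kg.

(* The constant of [curve_energy]. *)
Let C1 := C + Lg * (Lg + 1) / (2 * c).

Let C10 : 0 <= C1.
Proof. by rewrite addr_ge0// divr_ge0 ?mulr_ge0 ?addr_ge0// ltW. Qed.

Lemma value_le_cost t gamma : admissible T Omega gamma ->
  (value T Omega f g t (gamma t) <= cost T f g t gamma)%E.
Proof. by move=> adm; apply: ereal_inf_lbound; exists gamma. Qed.

Lemma value_le_constant_curve t x : 0 <= t -> t <= T -> closure Omega x ->
  (value T Omega f g t x <= (g x + C * (T - t))%:E)%E.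
Proof.
move=> t0 tT Kx; apply: le_trans (cost_constant_curve t0 tT Kx).
exact: (@value_le_cost t (cst x) (admissible_cst Kx)).
Qed.

Lemma value_lower_bound t x : 0 <= t -> t <= T -> closure Omega x ->
  ((- (Kg + C * T))%:E <= value T Omega f g t x)%E.
Proof.
move=> t0 tT Kx; apply: le_ereal_inf_tmp => _ [gamma [adm gx] <-].
apply: le_trans (cost_lower_bound t0 tT adm).
have gT : closure Omega (gamma T).
  by have [_] := adm; apply; rewrite in_itv /= lexx (le_trans t0 tT).
rewrite lee_fin opprD lerD//; first by have := g_bound gT; rewrite ler_norml => /andP[].
by rewrite lerN2 ler_wpM2l// gerBl.
Qed.

Lemma value_fin_num t x : 0 <= t -> t <= T -> closure Omega x ->
  value T Omega f g t x \is a fin_num.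
Proof.
move=> t0 tT Kx; rewrite fin_numElt; apply/andP; split.
  by apply: lt_le_trans (value_lower_bound t0 tT Kx); rewrite ltNyr.
by apply: le_lt_trans (value_le_constant_curve t0 tT Kx) _; rewrite ltry.
Qed.

Lemma value_bounded t x : 0 <= t -> t <= T -> closure Omega x ->
  `|fine (value T Omega f g t x)| <= Kg + C * T.
Proof.
move=> t0 tT Kx; have fin := value_fin_num t0 tT Kx.
rewrite ler_norml -2!lee_fin fineK// value_lower_bound//=.
apply: le_trans (value_le_constant_curve t0 tT Kx) _.
rewrite lee_fin lerD//; first by apply: le_trans (ler_norm _) (g_bound Kx).
by rewrite ler_wpM2l// gerBl.
Qed.

(** The lower bound holds because the energy of a curve is nonnegative. *)
Lemma value_near_final_time t x : 0 <= t -> t < T -> closure Omega x ->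
  g x - C1 * (T - t) <= fine (value T Omega f g t x) <= g x + C * (T - t).
Proof.
move=> t0 tT Kx; have fin := value_fin_num t0 (ltW tT) Kx.
rewrite -2!lee_fin fineK// value_le_constant_curve ?(ltW tT)// andbT.
apply: le_ereal_inf_tmp => _ [gamma [adm gx] <-].
have lo := cost_lower_bound t0 (ltW tT) adm.
case E : (cost T f g t gamma) => [r| |]; last 2 first.
- by rewrite leey.
- by move: lo; rewrite E.
have [N] := curve_energy t0 tT adm E.
cbv zeta => -[_ _ _ _]; rewrite gx -/C1 => h.
rewrite lee_fin lerBlDr -subr_ge0 addrAC.
apply: le_trans h; apply: mulr_ge0; first by rewrite divr_ge0// ltW.
by apply: Rintegral_ge0 => s _; exact: dotr_ge0.
Qed.

Variables (rho L : R).
Hypotheses (rho0 : 0 < rho) (L0 : 0 <= L).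
Hypothesis join : forall x y, closure Omega x -> closure Omega y ->
  `|x - y| < rho -> joinable (closure Omega) L x y.

(* [B] times [T - t] bounds the excess over [g] of almost optimal curves, as
   needed for [detour_cost], whose constant is then [C2]. *)
Let B := C + 1 + C1.
Let C2 := C * (1 + (n%:R * L) ^+ 2) + 2 * C + C * (2 * T + 4) * (1 + 2 * B / c).

(** Curves whose cost exceeds the infimum by at most [T - t] have energy at
    most a constant times [T - t], because the infimum is at most
    [g x + C * (T - t)]; the value at [(t', y)] is at most the cost of their
    detours. *)
Lemma value_detour t t' x y : 0 < t < T -> 0 < t' < T ->
  closure Omega x -> closure Omega y ->
  let d := `|t - t'| + `|x - y| in
  0 < d -> d < rho -> 4 * d <= T - t ->
  fine (value T Omega f g t' y) <= fine (value T Omega f g t x) + C2 * d.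
Proof.
have arith1 (r v gg a tau b : R) : r < v + a -> a <= tau -> v <= gg + C * tau ->
  r - gg + b * tau <= (C + 1 + b) * tau by lra.
have arith2 (r e v w a b : R) :
  r < v + a -> a <= e -> w <= r + b -> w <= v + b + e by lra.
move=> /andP[/ltW t0 tT] /andP[/ltW t'0 t'T] Kx Ky d d0 drho dT.
have fin := value_fin_num t0 (ltW tT) Kx.
have fin' := value_fin_num t'0 (ltW t'T) Ky.
have Tt : 0 < T - t by rewrite subr_gt0.
have xyd : `|x - y| <= d by rewrite lerDr.
have ttd : `|t - t'| <= d by rewrite lerDl.
have [p [p0 p1 pK plip]] := join Kx Ky (le_lt_trans xyd drho).
apply/ler_addgt0Pr => e e0.
pose e' := Num.min e (T - t).
have e'0 : 0 < e' by rewrite lt_min e0.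
have [_ [gamma [adm gx] <-]] := lb_ereal_inf_adherent e'0 fin.
rewrite -[ereal_inf _]/(value T Omega f g t x) => near_opt.
have lo := cost_lower_bound t0 (ltW tT) adm.
case E : (cost T f g t gamma) => [r| |]; last 2 first.
- by move: near_opt; rewrite E ltNge leey.
- by move: lo; rewrite E.
rewrite E -(fineK fin) -EFinD lte_fin in near_opt.
have /andP[_ up] := value_near_final_time t0 tT Kx.
have ee : e' <= e by rewrite ge_min lexx.
have eT : e' <= T - t by rewrite ge_min lexx orbT.
have rB : r - g (gamma t) + (C + Lg * (Lg + 1) / (2 * c)) * (T - t) <= B * (T - t).
  rewrite gx -/C1 /B.
  exact: arith1 near_opt eT up.
have B0 : 0 <= B by apply: addr_ge0 C10; exact: addr_ge0.
rewrite -gx in p1 xyd plip.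
have ady := detour_admissible t0 d0 L0 adm ttd xyd dT p1 pK plip.
have := detour_cost t0 tT t'0 d0 L0 adm ttd xyd dT
  p1 pK plip E B0 rB.
rewrite -/C2 => dc.
have := le_trans (@value_le_cost t' _ ady) dc.
rewrite (detour_start t t' gamma d0 p0) => vle.
have {vle} : fine (value T Omega f g t' y) <= r + C2 * d by rewrite -lee_fin fineK.
exact: arith2 near_opt ee.
Qed.

(* One summand for each of the three regimes of [d]. *)
Let C3 := C2 + 2 * (Kg + C * T) / rho + (5 * C + 4 * C1 + Lg).

(** When [d] is at least [rho] the bound on the value suffices, and when it is
    more than a quarter of [T - t] both values are close to those of [g]. *)
Lemma value_one_sided_lipschitz t t' x y : 0 < t < T -> 0 < t' < T ->
  closure Omega x -> closure Omega y ->
  fine (value T Omega f g t' y) <=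
    fine (value T Omega f g t x) + C3 * (`|t - t'| + `|x - y|).
Proof.
have arith1 (v w K : R) : - K <= v <= K -> - K <= w <= K -> w <= v + 2 * K by lra.
have arith2 (D : R) : T - t < 4 * D -> - D <= t - t' <= D -> T - t' <= 5 * D by lra.
have arith3 (v w gx gy a1 a2 a3 m1 m2 m3 D : R) :
  gx - a1 <= v -> w <= gy + a2 -> gy - gx <= a3 -> a3 <= m3 * D ->
  a2 <= m1 * (5 * D) -> a1 <= m2 * (4 * D) -> w <= v + (5 * m1 + 4 * m2 + m3) * D.
  by lra.
move=> tT t'T Kx Ky; have := @value_detour _ _ _ _ tT t'T Kx Ky.
set d := `|t - t'| + `|x - y|; rewrite /= => detour_bound.
have [t0 ltT] := andP tT; have [t'0 lt'T] := andP t'T.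
have b := value_bounded (ltW t0) (ltW ltT) Kx.
have b' := value_bounded (ltW t'0) (ltW lt'T) Ky.
have Bd0 : 0 <= Kg + C * T by apply: le_trans b.
have B20 : 0 <= 2 * (Kg + C * T) / rho by rewrite divr_ge0 ?mulr_ge0// ltW.
have B0 : 0 <= B by apply: addr_ge0 C10; exact: addr_ge0.
have T0 : 0 <= T by apply: ltW (lt_trans t0 ltT).
have C20 : 0 <= C2.
  by rewrite /C2 !addr_ge0 ?mulr_ge0 ?addr_ge0 ?sqr_ge0 ?divr_ge0 ?mulr_ge0// ltW.
have C40 : 0 <= 5 * C + 4 * C1 + Lg by rewrite !addr_ge0 ?mulr_ge0.
have d0 : 0 <= d by rewrite addr_ge0.
have [] := eqVneq d 0.
  move=> dE; rewrite dE mulr0 addr0.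
  have : `|t - t'| + `|x - y| == 0 by rewrite -/d dE.
  by rewrite (paddr_eq0 (normr_ge0 _) (normr_ge0 _)) !normr_eq0 !subr_eq0 => /andP[/eqP -> /eqP ->].
move=> dN0; have {dN0} dP : 0 < d by rewrite lt_neqAle eq_sym dN0.
have split3 (k1 k2 k3 v : R) : v <= (k1 + k2 + k3) * d ->
  fine (value T Omega f g t' y) <= fine (value T Omega f g t x) + v ->
  fine (value T Omega f g t' y) <= fine (value T Omega f g t x) + (k1 + k2 + k3) * d.
  by move=> h1 h2; apply: le_trans h2 _; rewrite lerD2l.
have [rd|dr] := leP rho d.
  apply: (split3 _ _ _ (2 * (Kg + C * T))).
    apply: (@le_trans _ _ (2 * (Kg + C * T) / rho * d)).
      by rewrite mulrAC ler_pdivlMr// ler_wpM2l// mulr_ge0.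
    by rewrite ler_wpM2r// -addrA addrCA lerDl addr_ge0.
  by rewrite !ler_norml in b b'; exact: arith1 b b'.
have [Td|dT] := ltP (T - t) (4 * d); last first.
  apply: split3 (detour_bound dP dr dT).
  by rewrite ler_wpM2r// -addrA lerDl addr_ge0.
have /andP[lo _] := value_near_final_time (ltW t0) ltT Kx.
have /andP[_ up] := value_near_final_time (ltW t'0) lt'T Ky.
apply: (split3 _ _ _ ((5 * C + 4 * C1 + Lg) * d)).
  by rewrite ler_wpM2r// lerDr addr_ge0.
have := g_lip Ky Kx; rewrite ler_norml distrC => /andP[_ gl].
have gl' : Lg * `|x - y| <= Lg * d by rewrite ler_wpM2l// lerDr.
have h1 : C * (T - t') <= C * (5 * d).
  rewrite ler_wpM2l//; apply: (arith2 _ Td); rewrite -ler_norml.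
  by rewrite lerDl.
have h2 : C1 * (T - t) <= C1 * (4 * d) by rewrite ler_wpM2l// ltW.
exact: arith3 lo up gl gl' h1 h2.
Qed.

Lemma value_lipschitz :
  [lipschitz fine (value T Omega f g p.1 p.2) |
    p in `]0, T[%classic `*` closure Omega].
Proof.
have arith1 (a b D : R) : a <= D -> b <= D -> a + b <= 2 * D by lra.
have arith2 (v w a D : R) : w <= v + a -> v <= w + a -> a <= D ->
  - D <= v - w <= D by lra.
rewrite /lipschitz_on; near=> M => -[[t x] [t' y]] /= [[t0 Kx] [t'0 Ky]].
have {}t0 : 0 < t < T by move: t0; rewrite /= in_itv.
have {}t'0 : 0 < t' < T by move: t'0; rewrite /= in_itv.
have h1 := value_one_sided_lipschitz t0 t'0 Kx Ky.
have h2 := value_one_sided_lipschitz t'0 t0 Ky Kx.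
rewrite (distrC t') (distrC y) in h2.
(* The product carries the maximum norm, which bounds each of the distances. *)
set D := `|(t, x) - (t', y)|.
have d1 : `|t - t'| <= D by rewrite /D prod_normE /= le_max lexx.
have d2 : `|x - y| <= D by rewrite /D prod_normE /= le_max lexx orbT.
have M0 : 2 * `|C3| <= M by near: M; apply: nbhs_pinfty_ge; exact: num_real.
have D0 : 0 <= D by exact: normr_ge0.
have : C3 * (`|t - t'| + `|x - y|) <= M * D.
  apply: (@le_trans _ _ (`|C3| * (2 * D))).
    have h : `|t - t'| + `|x - y| <= 2 * D by exact: arith1.
    apply: le_trans (ler_wpM2r _ (ler_norm C3)) (ler_wpM2l _ h) => //; exact: addr_ge0.
  by rewrite mulrCA mulrA ler_wpM2r.
by rewrite ler_norml; exact: arith2 h1 h2.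
Unshelve. all: by end_near. Qed.

End value_function.

Theorem proposition4p1 (R : realType) (n : nat) (T : R)
    (Omega U : set 'rV[R]_n)
    (f : R -> 'rV[R]_n -> 'rV[R]_n -> R) (g : 'rV[R]_n -> R)
    (hT : 0 < T)
    (Omega_open : open Omega) (Omega_bounded : bounded_set Omega)
    (Omega_C2 : C2_boundary Omega)
    (U_open : open U) (Omega_U : closure Omega `<=` U)
    (f0 : hyp_f0 T U f) (f1 : hyp_f1 T U f) (f2 : hyp_f2 T U f)
    (g1 : hyp_g1 U g) :
  (forall (t : R) (x : 'rV[R]_n), t \in `[0, T] -> closure Omega x ->
    value T Omega f g t x \is a fin_num) /\
  [lipschitz fine (value T Omega f g p.1 p.2) |
    p in `]0, T[%classic `*` closure Omega].
Proof.
have [c [C [c0 C0 fb]]] := lagrangian_bounds f0 f1 f2.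
have [rho [L [rho0 join]]] := closure_joinable Omega_open Omega_bounded Omega_C2.
have [Kg [Lg [Lg0 gb gl]]] := final_cost_lipschitz Omega_bounded U_open Omega_U g1.
split=> [t x|].
  rewrite in_itv /= => /andP[t0 tT]; exact: (value_fin_num Omega_U c0 C0 fb gb).
have L0 : 0 <= Num.max 0 L by rewrite le_max lexx.
apply: (value_lipschitz Omega_U f0 c0 C0 Lg0 fb gl gb rho0 L0) => x y Kx Ky xy.
by apply: joinable_le (join x y Kx Ky xy); rewrite le_max lexx orbT.
Qed.
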